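(* Let $\Theta=[0,1]$ and let Assumptions 1–4 hold. If $|\Gamma^\star_a|\le2$ for all $a\in A$ (the contact set is pairwise) and full disclosure is optimal, then full disclosure is the unique optimal outcome.
   Context: Setting. $A=[0,1]$ is the set of actions and $\overline\Theta=[0,1]$ the set of states. For a compact metric space $X$, $\Delta(X)$ is the set of Borel probability measures on $X$ (weak* topology) and $\operatorname{supp}(\eta)$ is the smallest compact set of $\eta$-measure one. The prior is $\phi\in\Delta(\overline\Theta)$, with support $\Theta=\operatorname{supp}(\phi)$. The sender's and receiver's utilities are $V,U:A\times\overline\Theta\to\mathbb R$. $\delta_\theta$ is the Dirac measure at $\theta$. Assumption 1: $V(a,\theta)$ and $U(a,\theta)$ are differentiable in $a$; $v=\partial V/\partial a$ and $u=\partial U/\partial a$ are continuous in $(a,\theta)$; $u$ is differentiable in $a$ and $u_a=\partial u/\partial a$ is continuous in $(a,\theta)$. Assumption 2 (strict aggregate quasi-concavity): for every $a\in A$ and every $\mu\in\Delta(\Theta)$, $\int u(a,\theta)\,d\mu(\theta)=0$ implies $\int u_a(a,\theta)\,d\mu(\theta)<0$. Assumption 3: $\min_{\theta\in\overline\Theta}u(0,\theta)=\max_{\theta\in\overline\Theta}u(1,\theta)=0$. Assumption 4 (strict single crossing): for all $a\in A$ and $\theta<\theta'$, $u(a,\theta)=0$ implies $u(a,\theta')>0$. Under Assumptions 1–3, for each $\mu\in\Delta(\Theta)$ the receiver's optimal action $a^\star(\mu)$ is unique and is the unique $a$ with $\int u(a,\theta)\,d\mu=0$. Under Assumptions 1–4,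 for each $a\in A$ there is a unique $\theta^\star(a)\in\overline\Theta$ with $u(a,\theta^\star(a))=0$, and $\theta^\star$ is continuous and strictly increasing from $A$ onto $\overline\Theta$. An outcome is $\pi\in\Delta(A\times\Theta)$. It is implementable if (P1) its marginal on $\Theta$ equals $\phi$ and (P2) $\int_{\tilde A\times\Theta}u(a,\theta)\,d\pi(a,\theta)=0$ for every measurable $\tilde A\subset A$. It is optimal if it maximizes $\int V\,d\pi$ over implementable outcomes. The full-disclosure outcome is the image of $\phi$ under $\theta\mapsto(a^\star(\delta_\theta),\theta)$. The dual problem (D) is to choose $p\in C(\Theta)$ and a bounded measurable $q:A\to\mathbb R$ to minimize $\int_\Theta p\,d\phi$ subject to $p(\theta)-q(a)u(a,\theta)\ge V(a,\theta)$ for all $(a,\theta)\in A\times\Theta$. Contact set. Let $p\in C(\Theta)$ be the (unique) solution of (D). Let $\tilde q(a,\theta)=v(a,\theta)/(-u_a(a,\theta))$ if $u(a,\theta)=0$ and $\tilde q(a,\theta)=(V(a^\star(\delta_\theta),\theta)-V(a,\theta))/u(a,\theta)$ if $u(a,\theta)\ne0$, let $C=\max_{A\times\Theta}|\tilde q|$ and $I=[-C,C]$. For $a\in A$ let $Q(a)=\{r\in I:\ p(\theta)\ge V(a,\theta)+r\,u(a,\theta)\text{ for all }\theta\in\Theta\}$ (a nonempty compact interval). Define $q(a)=v(a,\theta^\star(a))/(-u_a(a,\theta^\star(a)))$ if $\theta^\star(a)\in\Theta$ and $p(\theta^\star(a))=V(a,\theta^\star(a))$, and $q(a)=(\min Q(a)+\max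 Q(a))/2$ otherwise. The contact set is $\Gamma=\{(a,\theta)\in A\times\Theta: p(\theta)=V(a,\theta)+q(a)u(a,\theta)\}$, with $a$-sections $\Gamma_a=\{\theta:(a,\theta)\in\Gamma\}$. The set $\Gamma^\star\subset\Gamma$ has $a$-sections $\Gamma^\star_a=\{\theta^\star(a)\}$ if $\Gamma_a\ne\emptyset$ and $\theta^\star(a)\in\{\min\Gamma_a,\max\Gamma_a\}$, and $\Gamma^\star_a=\Gamma_a$ otherwise.
   Formalization: The sender's and receiver's utilities V and U are additionally assumed jointly continuous in (a,θ); with V only differentiable in a with continuous v, subtracting 1 from V at a single null state can break uniqueness. *)

(* Defs.v *)
From HB Require Import structures.
From mathcomp Require Import all_boot all_order all_algebra.
From mathcomp Require Import all_classical all_reals all_analysis.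
Set Implicit Arguments. Unset Strict Implicit. Unset Printing Implicit Defensive.
Import Order.TTheory GRing.Theory Num.Theory.
Import numFieldNormedType.Exports.
Local Open Scope classical_set_scope.
Local Open Scope ring_scope.

Section Defs.
Variable R : realType.

(* The unit interval [0,1] (= A = Theta-bar = Theta). *)
Definition I01 : set R := [set x | 0 <= x <= 1].

Definition cont2_on01 (f : R -> R -> R) : Prop :=
  forall a t, I01 a -> I01 t -> forall e : R, 0 < e ->
    exists2 d : R, 0 < d & forall a' t', I01 a' -> I01 t' ->
      `|a' - a| < d -> `|t' - t| < d -> `|f a' t' - f a t| < e.

Definition deriv01 (f : R -> R) (a l : R) : Prop :=
  (fun b => (f b - f a) / (b - a)) @ within [set b | I01 b /\ b != a] (nbhs a)
    --> l.

Definition assumption1 (V U v u ua : R -> R -> R) : Prop :=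
  (forall a t, I01 a -> I01 t ->
     deriv01 (V^~ t) a (v a t) /\ deriv01 (U^~ t) a (u a t) /\
     deriv01 (u^~ t) a (ua a t)) /\
  cont2_on01 v /\ cont2_on01 u /\ cont2_on01 ua.

Definition prob01 (mu : probability R R) : Prop := mu I01 = 1%E.

Definition assumption2 (u ua : R -> R -> R) : Prop :=
  forall a, I01 a -> forall mu : probability R R, prob01 mu ->
    (\int[mu]_(t in I01) (u a t)%:E = 0)%E ->
    (\int[mu]_(t in I01) (ua a t)%:E < 0)%E.

Definition assumption3 (u : R -> R -> R) : Prop :=
  ((forall t, I01 t -> 0 <= u 0 t) /\ (exists2 t, I01 t & u 0 t = 0)) /\
  ((forall t, I01 t -> u 1 t <= 0) /\ (exists2 t, I01 t & u 1 t = 0)).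

Definition assumption4 (u : R -> R -> R) : Prop :=
  forall a t t', I01 a -> I01 t -> I01 t' -> t < t' -> u a t = 0 -> 0 < u a t'.

(* a*(delta_t): the (unique under Assumptions 1-3) a in [0,1] with u(a,t)=0. *)
Definition astar_pt (u : R -> R -> R) (t : R) : R :=
  xget 0 [set a | I01 a /\ u a t = 0].

(* theta*(a): the (unique under Assumptions 1-4) t in [0,1] with u(a,t)=0. *)
Definition thetastar (u : R -> R -> R) (a : R) : R :=
  xget 0 [set t | I01 t /\ u a t = 0].

Definition supp_is_01 (phi : probability R R) : Prop :=
  phi I01 = 1%E /\
  forall x, I01 x -> forall e : R, 0 < e -> (0 < phi [set y | (`|y - x| < e)%R])%E.

Definition outcome (pi : probability (R * R)%type R) : Prop :=
  pi (I01 `*` I01) = 1%E.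

Definition implementable (phi : probability R R) (u : R -> R -> R)
    (pi : probability (R * R)%type R) : Prop :=
  outcome pi /\
  (forall B : set R, measurable B -> pi (I01 `*` B) = phi B) /\
  (forall At : set R, measurable At ->
     (\int[pi]_(z in (At `&` I01) `*` I01) (u z.1 z.2)%:E = 0)%E).

Definition sender_value (V : R -> R -> R) (pi : probability (R * R)%type R) :=
  (\int[pi]_(z in I01 `*` I01) (V z.1 z.2)%:E)%E.

Definition optimal (phi : probability R R) (V u : R -> R -> R)
    (pi : probability (R * R)%type R) : Prop :=
  implementable phi u pi /\
  forall pi', implementable phi u pi' -> (sender_value V pi' <= sender_value V pi)%E.

Definition full_disclosure (phi : probability R R) (u : R -> R -> R)
    (pi : probability (R * R)%type R) : Prop :=
  forall E : set (R * R), measurable E ->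
    pi E = phi ((fun t => (astar_pt u t, t)) @^-1` E).

Definition dual_feasible (V u : R -> R -> R) (p q : R -> R) : Prop :=
  {within I01, continuous p} /\
  measurable_fun I01 q /\
  (exists M : R, forall a, I01 a -> `|q a| <= M) /\
  (forall a t, I01 a -> I01 t -> V a t <= p t - q a * u a t).

Definition dual_solution (phi : probability R R) (V u : R -> R -> R)
    (p : R -> R) : Prop :=
  (exists q, dual_feasible V u p q) /\
  forall p' q', dual_feasible V u p' q' ->
    (\int[phi]_(t in I01) (p t)%:E <= \int[phi]_(t in I01) (p' t)%:E)%E.

Definition qtilde (V v u ua : R -> R -> R) (a t : R) : R :=
  if u a t == 0 then v a t / (- ua a t)
  else (V (astar_pt u t) t - V a t) / u a t.

Definition Cbound (V v u ua : R -> R -> R) : R :=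
  sup [set `|qtilde V v u ua a t| | a in I01 & t in I01].

Definition Qset (V v u ua : R -> R -> R) (p : R -> R) (a : R) : set R :=
  [set r | - Cbound V v u ua <= r <= Cbound V v u ua /\
     forall t, I01 t -> V a t + r * u a t <= p t].

Definition qmult (V v u ua : R -> R -> R) (p : R -> R) (a : R) : R :=
  let ts := thetastar u a in
  if `[< I01 ts /\ p ts = V a ts >] then v a ts / (- ua a ts)
  else (inf (Qset V v u ua p a) + sup (Qset V v u ua p a)) / 2.

Definition Gamma (V v u ua : R -> R -> R) (p : R -> R) : set (R * R) :=
  [set z | I01 z.1 /\ I01 z.2 /\
     p z.2 = V z.1 z.2 + qmult V v u ua p z.1 * u z.1 z.2].

Definition Gamma_sec (V v u ua : R -> R -> R) (p : R -> R) (a : R) : set R :=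
  [set t | Gamma V v u ua p (a, t)].

Definition Gammastar_sec (V v u ua : R -> R -> R) (p : R -> R) (a : R) : set R :=
  let G := Gamma_sec V v u ua p a in
  if `[< G !=set0 /\
        (thetastar u a = inf G \/ thetastar u a = sup G) >]
  then [set thetastar u a] else G.

Definition at_most_two (S : set R) : Prop :=
  exists x y : R, S `<=` [set x; y].

End Defs.

(* Main.v *)
Require Import Defs.
From HB Require Import structures.
From mathcomp Require Import all_boot all_order all_algebra.
From mathcomp Require Import all_classical all_reals all_analysis.
From mathcomp Require Import measurable_realfun ring lra.
Import Order.TTheory GRing.Theory Num.Theory.
Import numFieldNormedType.Exports.
Local Open Scope classical_set_scope.
Local Open Scope ring_scope.

(* No general strong duality is needed. If disclosure is optimal, then pooling
   small masses around two states t1 < theta*(a) < t2 so as to induce a exactly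
   cannot help, which says that the slopes (P(t) - V(a,t)) / u(a,t), where
   P(t) = V(a*(t),t), are separated by some r(a). The first-order condition at
   theta*(a) forces r(a) = v/(-u_a), which is continuous, so (P, r) is dual
   feasible. Every feasible price lies above P, hence p = P by full support, and
   theta*(a) belongs to every section Gamma_a. Pairwiseness then makes theta*(a)
   an endpoint of Gamma_a, so u(a,.) has constant sign on Gamma_a. An optimal
   outcome is carried by the contact set; obedience on the set of actions of each
   sign gives u = 0 almost surely, i.e. a = a*(t). *)

(** When [phi] has no atoms, two states cannot be pooled as points, and obedience at the pooled
    action has to hold with equality. Both points are met by pooling whole sets of states and
    randomizing between two deterministic pooling maps: a single weight balances the two integrals
    of u, and the sets need no adjustment. No differentiability in the state is assumed, so the
    first-order condition is taken in the action: P(t) - V(a,t) and u(a,t) are both written as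
    multiples of a*(t) - a. The condition is worth the effort because a separating slope chosen
    action by action, as a supremum, carries no visible measurability in a, whereas the closed
    formula is continuous; continuity also reaches the actions 0 and 1, where only one side of
    slopes is available. Finally, knowing p and q explicitly makes the contact set the zero set of a
    continuous function on the square. This is what makes the actions sorted by sign a measurable
    set, as obedience requires. *)

Section Plane.
Context {R : realType}.

(** The sigma-algebra on the plane is generated by rectangles, so second countability is used: the
    open set is the union of the squares with rational centre and half-width [1/(n+1)] that it
    contains. *)
Lemma open_measurable_plane (O : set (R * R)) : open O -> measurable O.
Proof.
move=> oO.
pose rect (q : rat * rat * nat) : set (R * R) :=
  `]ratr q.1.1 - q.2.+1%:R^-1, ratr q.1.1 + q.2.+1%:R^-1[ `*`
  `]ratr q.1.2 - q.2.+1%:R^-1, ratr q.1.2 + q.2.+1%:R^-1[.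
pose F q := if `[< rect q `<=` O >] then rect q else set0.
have -> : O = \bigcup_q F q.
  apply/seteqP; split => [[x y] Oxy|z [q _]]; last first.
    by rewrite /F; case: asboolP => // H /H.
  have [[A B] /= [nA nB] ABO] : nbhs (x, y) O by exact: open_nbhs_nbhs.
  move: nA nB => /nbhs_ballP[d1 /= d10 HA] /nbhs_ballP[d2 /= d20 HB].
  pose d := Order.min d1 d2.
  have d0 : 0 < d by rewrite lt_min d10.
  (* A square of half-width w that contains the point stays within 2w of it in each coordinate,
     hence the requirement 2w < d. *)
  pose n := Num.truncn (2 / d).
  have nd : 2 / d < n.+1%:R by exact: truncnS_gt.
  have n0 : 0 < n.+1%:R^-1 :> R by rewrite invr_gt0.
  have nd2 : 2 * n.+1%:R^-1 < d.
    by rewrite ltr_pdivrMr// mulrC -ltr_pdivrMr.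
  have [w wE] : exists w : R, w = n.+1%:R^-1 by exists n.+1%:R^-1.
  rewrite -wE in n0 nd2.
  have itvx : x - w < x + w by lra.
  have itvy : y - w < y + w by lra.
  have [p] := rat_in_itvoo itvx; rewrite in_itv /= => /andP[px1 px2].
  have [q] := rat_in_itvoo itvy; rewrite in_itv /= => /andP[qy1 qy2].
  exists (p, q, n) => //; rewrite /F /rect /= -wE; case: asboolP => [_|].
    by split; rewrite /= in_itv /=; apply/andP; split; lra.
  case=> -[x' y'] [] /=; rewrite !in_itv /= => /andP[? ?] /andP[? ?].
  have dd1 : d <= d1 by rewrite ge_min lexx.
  have dd2 : d <= d2 by rewrite ge_min lexx orbT.
  apply: ABO; split => /=.
    by apply: HA; rewrite /ball /=; apply/ltr_normlP; split; lra.
  by apply: HB; rewrite /ball /=; apply/ltr_normlP; split; lra.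
apply: countable_bigcupT_measurable => // q; rewrite /F; case: asboolP => // _.
by apply: measurableX; exact: measurable_itv.
Qed.

Lemma continuous_measurable_plane (f : R * R -> R) : continuous f ->
  measurable_fun setT f.
Proof.
move=> /continuousP cf; apply: (measurability _ (RGenOInfty.measurableE R)).
move=> _ [_ [x ->] <-]; rewrite setTI.
by apply: open_measurable_plane; apply: cf; exact: rray_open.
Qed.

End Plane.

(** * Integrals of bounded functions on a probability space *)

Section Bounded.
Context {d} {T : measurableType d} {R : realType} (P : probability T R).
Implicit Types f g : T -> R.

Lemma probability_integrable f M : measurable_fun setT f ->
  (forall x, `|f x| <= M) -> P.-integrable setT (EFin \o f).
Proof.
move=> mf fM; apply: measurable_bounded_integrable => //.
  by apply: le_lt_trans (probability_le1 P measurableT) _; exact: ltry.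
exists M; split; first exact: num_real.
by move=> N MN x _ /=; apply: le_trans (ltW MN).
Qed.

Lemma Rintegral_cst_probability (c : R) : \int[P]_x c = c.
Proof. rewrite Rintegral_cst// (_ : fine _ = 1) ?mulr1//.
have -> // : (P : measure _ _) setT = 1%E; exact: probability_setT. Qed.

Lemma Rintegral_bound f M : measurable_fun setT f ->
  (forall x, `|f x| <= M) -> `|\int[P]_x f x| <= M.
Proof.
move=> mf fM; have If := probability_integrable f M mf fM.
apply: le_trans (le_normr_Rintegral measurableT If) _.
rewrite -[leRHS]Rintegral_cst_probability; apply: le_Rintegral => //.
- apply: (@probability_integrable _ M); first exact: measurableT_comp.
  by move=> x; rewrite normr_id.
- by apply: (@probability_integrable _ `|M|) => //; exact: measurable_cst.
Qed.

Lemma measurable_neq0 f : measurable_fun setT f -> measurable [set x | f x != 0].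
Proof.
move=> mf; rewrite (_ : [set _ | _] = f @^-1` (~` [set 0])).
  by rewrite -[X in measurable X]setTI; apply: mf => //; exact: measurableC.
by apply/seteqP; split => x /= /eqP.
Qed.

Lemma Rintegral_eq0_null f M : measurable_fun setT f ->
  (forall x, 0 <= f x <= M) -> \int[P]_x f x = 0 -> P [set x | f x != 0] = 0%E.
Proof.
move=> mf fM If0.
have fn x : `|f x| = f x by rewrite ger0_norm//; case/andP: (fM x).
have If : P.-integrable setT (EFin \o f).
  by apply: (@probability_integrable _ M) => // x; rewrite fn; case/andP: (fM x).
have mE : measurable_fun setT (EFin \o f) by exact/measurable_EFinP.
have : ae_eq P setT (EFin \o f) (cst 0%E).
  apply/ae_eq_integral_abs => //.
  under eq_integral do rewrite /= fn.
  rewrite -[LHS]fineK; last exact: integrable_fin_num.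
  by congr EFin; exact: If0.
rewrite /ae_eq => -[N [mN N0 sub]].
have mf0 := measurable_neq0 _ mf.
apply: (@subset_measure0 _ _ _ P _ N) => // x /= fx; apply: sub => /= H.
by move: fx; have [->] := H I; rewrite eqxx.
Qed.

Lemma measure_eq_off_null (A B N : set T) : measurable A -> measurable B ->
  measurable N -> P N = 0%E -> A `\` N = B `\` N -> P A = P B.
Proof.
move=> mA mB mN N0 AB.
have off C : measurable C -> P C = P (C `\` N).
  move=> mC.
  have CN0 : P (C `&` N) = 0%E.
    by apply: (@subset_measure0 _ _ _ P _ N) => //; exact: measurableI.
  transitivity (P (C `\` N) + P (C `&` N))%E; first exact: measureDI.
  by rewrite CN0 adde0.
by rewrite (off A)// AB -off.
Qed.

(** The function agrees off [N] with its absolute value, to which the nonnegative case applies. This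
    form is needed because the sign of u is known only on the contact set, which carries the outcome
    up to a null set. *)
Lemma Rintegral_eq0_null_ae f M N : measurable_fun setT f ->
  (forall x, `|f x| <= M) -> measurable N -> P N = 0%E ->
  (forall x, ~ N x -> 0 <= f x) -> \int[P]_x f x = 0 ->
  P [set x | f x != 0] = 0%E.
Proof.
move=> mf fM mN N0 f0 If0.
rewrite (_ : [set x | f x != 0] = [set x | `|f x| != 0]); last first.
  by apply/seteqP; split => x /=; rewrite normr_eq0.
have mnf : measurable_fun setT (fun x => `|f x|) by exact: measurableT_comp.
apply: (@Rintegral_eq0_null _ M) => //.
  by move=> x; rewrite normr_ge0 fM.
rewrite -If0; congr fine; apply: ae_eq_integral => //; [exact/measurable_EFinP..|].
exists N; split => // x /= H; apply: contrapT => Nx; apply: H => _.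
by rewrite ger0_norm// f0.
Qed.

(** Bridge between integrals over the unit interval or square and integrals over the whole space:
    [f] is controlled on [D] only, while [g] is a well-behaved extension, in practice one obtained
    by clamping. *)
Lemma Rintegral_full (D : set T) f g M : measurable D -> P D = 1%E ->
  measurable_fun setT g -> (forall x, `|g x| <= M) ->
  (forall x, D x -> f x = g x) ->
  (\int[P]_(x in D) (f x)%:E = (\int[P]_x g x)%:E)%E.
Proof.
move=> mD PD mg gM fg; have Ig := probability_integrable g M mg gM.
rewrite fineK; last exact: integrable_fin_num.
have mND : measurable (~` D) by exact: measurableC.
have ND0 : P (~` D) = 0%E.
  by rewrite probability_setC// PD subee.
rewrite (negligible_integral mND measurableT Ig ND0) setTD setCK.
by apply: eq_integral => x; rewrite inE => /fg ->.
Qed.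

(* Subtracting C/2 times the indicator of the level set {C/2 <= q} from q with
   0 <= q <= C does not change the integral and halves the range of q; this
   replaces an approximation by simple functions. *)
Lemma Rintegral_level_mult (h g : T -> R) (M : R) :
  measurable_fun setT h -> measurable_fun setT g -> (forall x, `|g x| <= M) ->
  (forall B : set R, measurable B -> \int[P]_x (g x * \1_B (h x)) = 0) ->
  forall (q : R -> R) K, measurable_fun setT q -> (forall y, `|q y| <= K) ->
  \int[P]_x (g x * q (h x)) = 0.
Proof.
move=> mh mg gM g0.
have M0 : 0 <= M by apply: le_trans (gM point); exact: normr_ge0.
have comp_int (q : R -> R) K : measurable_fun setT q -> (forall y, `|q y| <= K) ->
    P.-integrable setT (EFin \o (fun x => g x * q (h x))).
  move=> mq qK; apply: (@probability_integrable _ (M * K)).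
    by apply: measurable_funM => //; exact: measurableT_comp.
  by move=> x; rewrite normrM; apply: ler_pM.
have ind_b (B : set R) y : `|\1_B y| <= 1 :> R.
  by rewrite indicE; case: (_ \in _); rewrite ?normr1 ?normr0.
have halve n : forall (q : R -> R) C, 0 <= C -> measurable_fun setT q ->
    (forall y, 0 <= q y <= C) -> `|\int[P]_x (g x * q (h x))| <= M * (C / 2 ^+ n).
  elim: n => [|n IH] q C C0 mq qC.
    rewrite expr0 divr1; apply: Rintegral_bound.
      by apply: measurable_funM => //; exact: measurableT_comp.
    move=> x; rewrite normrM; apply: ler_pM => //.
    by case/andP: (qC (h x)) => ? ?; rewrite ger0_norm.
  pose B := [set y | C / 2 <= q y].
  have mB : measurable B.
    rewrite (_ : B = q @^-1` `[C / 2, +oo[%classic).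
      by rewrite -[X in measurable X]setTI; apply: mq.
    by apply/seteqP; split => y; rewrite /B /= in_itv /= andbT.
  pose q' y := q y - C / 2 * \1_B y.
  have mC : measurable_fun setT (fun y => C / 2 * \1_B y : R).
    by apply: measurable_funM => //; exact: measurable_indic.
  have mq' : measurable_fun setT q' by exact: measurable_funB.
  have q'C y : 0 <= q' y <= C / 2.
    rewrite /q' indicE; case/andP: (qC y) => ? ?.
    case: (boolP (y \in B)) => yB; rewrite /= ?mulr1n ?mulr0n.
      move: yB; rewrite inE /B /= => yB; apply/andP; split; lra.
    have : ~~ (C / 2 <= q y) by apply: contra yB => yB; rewrite inE.
    rewrite -ltNge => ?; apply/andP; split; lra.
  have -> : \int[P]_x (g x * q (h x)) = \int[P]_x (g x * q' (h x)).
    have q'b y : `|q' y| <= C / 2 by case/andP: (q'C y) => ? ?; rewrite ger0_norm.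
    transitivity (\int[P]_x (g x * q' (h x) + C / 2 * (g x * \1_B (h x)))).
      by apply: eq_Rintegral => x _; rewrite /q'; ring.
    have mI : measurable_fun setT (\1_B : R -> R) by exact: measurable_indic.
    have IB := comp_int _ _ mI (ind_b B).
    rewrite RintegralD//; last 2 first.
    - exact: comp_int q'b.
    - apply: (@probability_integrable _ (`|C / 2| * (M * 1))).
        apply: measurable_funM => //; apply: measurable_funM => //.
        exact: measurableT_comp.
      by move=> x; rewrite !normrM; apply: ler_pM => //; apply: ler_pM.
    by rewrite RintegralZl// g0// mulr0 addr0.
  apply: le_trans (IH _ (C / 2) _ mq' q'C) _; first by lra.
  by rewrite (_ : C / 2 ^+ n.+1 = C / 2 / 2 ^+ n)// exprS invfM mulrA.
have nonneg (q : R -> R) C : measurable_fun setT q -> (forall y, 0 <= q y <= C) ->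
    \int[P]_x (g x * q (h x)) = 0.
  move=> mq qC; have C0 : 0 <= C by case/andP: (qC 0) => /le_trans; apply.
  apply/eqP; rewrite -normr_eq0; apply/eqP/le_anti; rewrite normr_ge0 andbT.
  apply/ler_addgt0Pl => e e0; rewrite addr0.
  have [n nP] : exists n, M * (C / 2 ^+ n) <= e.
    exists (Num.truncn (M * C / e)).
    rewrite mulrA ler_pdivrMr ?exprn_gt0// [e * _]mulrC -ler_pdivrMr//.
    apply: le_trans (ltW (truncnS_gt _)) _.
    by rewrite -natrX ler_nat ltn_expl.
  exact: le_trans (halve n q C C0 mq qC) nP.
move=> q K mq qK.
have K0 : 0 <= K by apply: le_trans (qK 0); exact: normr_ge0.
(* A signed [q] is shifted by its bound [K] to become nonnegative; the extra term integrates to zero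
   by the hypothesis at [B = setT]. *)
have mqK : measurable_fun setT (fun y => q y + K) by exact: measurable_funD.
have q0 : \int[P]_x (g x * (q (h x) + K)) = 0.
  apply: (nonneg _ (K + K) mqK) => y.
  by move/ler_normlP: (qK y) => [? ?]; apply/andP; split; lra.
have g1 : \int[P]_x (g x * K) = 0.
  rewrite RintegralZr//; last exact: probability_integrable gM.
  have := g0 setT measurableT.
  under eq_Rintegral do rewrite indicT /= mulr1.
  by move=> ->; rewrite mul0r.
have := comp_int _ _ mq qK => Iq.
have IK : P.-integrable setT (EFin \o (fun x => g x * K)).
  by apply: (comp_int (cst K) K) => [|y]; [exact: measurable_cst|rewrite /= ger0_norm].
have := RintegralD measurableT Iq IK.
under eq_Rintegral do rewrite -mulrDr.
by rewrite q0 g1 addr0.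
Qed.

End Bounded.

(** * Convex combinations of probabilities *)

Section Mixture.
Context {d} {T : measurableType d} {R : realType} (P1 P2 : probability T R).
Variables c1 c2 : {nonneg R}.
Hypothesis c12 : c1%:num + c2%:num = 1.

(** The proof that the weights sum to one is an argument of the term, so that the probability
    instance can be attached to [mixture c12]. *)
Definition mixture of c1%:num + c2%:num = 1 : set T -> \bar R :=
  measure_add (mscale c1 P1) (mscale c2 P2).

HB.instance Definition _ := Measure.on (mixture c12).

Lemma mixtureE E : (mixture c12 E = c1%:num%:E * P1 E + c2%:num%:E * P2 E)%E.
Proof. exact: (measure_addE (mscale c1 P1) (mscale c2 P2) E). Qed.

Let mixture_setT : mixture c12 setT = 1%E.
Proof.
have [e1 e2] := (@probability_setT _ _ _ P1, @probability_setT _ _ _ P2).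
by rewrite mixtureE [P1 _]e1 [P2 _]e2 !mule1 -EFinD c12.
Qed.

HB.instance Definition _ :=
  Measure_isProbability.Build _ _ _ (mixture c12) mixture_setT.

Lemma Rintegral_mixture (f : T -> R) M : measurable_fun setT f ->
  (forall x, `|f x| <= M) -> \int[mixture c12]_x f x =
    c1%:num * \int[P1]_x f x + c2%:num * \int[P2]_x f x.
Proof.
move=> mf fM.
have mE : measurable_fun setT (EFin \o f) by exact/measurable_EFinP.
have scale (k : {nonneg R}) (Q : probability T R) :
    (mscale k Q).-integrable setT (EFin \o f) /\
    (\int[mscale k Q]_x (f x)%:E = k%:num%:E * \int[Q]_x (f x)%:E)%E.
  split.
    apply: measurable_bounded_integrable => //.
      rewrite /= /mscale /=; apply: lte_mul_pinfty => //.
      by apply: le_lt_trans (probability_le1 Q measurableT) _; exact: ltry.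
    exists M; split; first exact: num_real.
    by move=> N MN x _ /=; apply: le_trans (ltW MN).
  rewrite [LHS]integralE [X in _ = (_ * X)%E]integralE.
  have IQ := probability_integrable Q f M mf fM.
  have /integrable_fin_num pQ := integrable_funepos measurableT IQ.
  have /integrable_fin_num nQ := integrable_funeneg measurableT IQ.
  rewrite !ge0_integral_mscale//; last 2 first.
  - exact: measurable_funeneg.
  - exact: measurable_funepos.
  rewrite [RHS]muleBr//; apply: fin_num_adde_defr.
  by rewrite pQ.
have [i1 e1] := scale c1 P1.
have [i2 e2] := scale c2 P2.
have eI := integral_measure_add measurableT i1 i2; rewrite /= e1 e2 in eI.
rewrite (_ : \int[mixture c12]_x f x = fine
  (c1%:num%:E * \int[P1]_x (f x)%:E + c2%:num%:E * \int[P2]_x (f x)%:E)%E);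
  last by rewrite -eI.
have I1 := integrable_fin_num measurableT (probability_integrable P1 f M mf fM).
have I2 := integrable_fin_num measurableT (probability_integrable P2 f M mf fM).
by rewrite fineD ?fin_numM// !fineM.
Qed.

End Mixture.

Section Pushforward.
Context {d1} {d2} {T1 : measurableType d1} {T2 : measurableType d2} {R : realType}.

(** [Q] is tied to the image of [P] only by its values on measurable sets, so the same lemma serves
    marginals, the disclosure outcome and the laws of pooling maps. *)
Lemma Rintegral_pushforward_eq (P : probability T1 R) (Q : probability T2 R)
    (h : T1 -> T2) (f : T2 -> R) M :
  measurable_fun setT h -> measurable_fun setT f -> (forall y, `|f y| <= M) ->
  (forall E, measurable E -> Q E = P (h @^-1` E)) ->
  \int[Q]_y f y = \int[P]_x f (h x).
Proof.
move=> mh mf fM QE; congr fine.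
have mE : measurable_fun setT (EFin \o f) by exact/measurable_EFinP.
have Ih : P.-integrable (h @^-1` setT) ((EFin \o f) \o h).
  rewrite preimage_setT; apply: (@probability_integrable _ _ _ P (f \o h) M).
    exact: measurableT_comp.
  by move=> x; exact: fM.
have := @integral_pushforward _ _ _ _ _ h mh P setT (EFin \o f) mE Ih measurableT.
rewrite preimage_setT => <-.
by apply: eq_measure_integral => E mE' _; exact: QE.
Qed.

End Pushforward.

(** * Calculus on the unit interval through the retraction [clamp01] *)

Section Clamp.
Context {R : realType}.
Implicit Types (x y : R).

(* Precomposing with the retraction onto [0,1] turns continuity on [0,1] into
   continuity on the whole line. *)
Definition clamp01 (x : R) : R := Order.max 0 (Order.min 1 x).

Lemma clamp01P x : [\/ x <= 0 /\ clamp01 x = 0, I01 x /\ clamp01 x = x |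
  1 <= x /\ clamp01 x = 1].
Proof.
rewrite /clamp01 /I01 /=; case: (leP 1 x) => x1.
  by rewrite max_r//; constructor 3.
case: (leP 0 x) => x0; first by constructor 2; split=> //; exact: ltW.
by constructor 1; split=> //; exact: ltW.
Qed.

Lemma clamp01_in x : I01 (clamp01 x).
Proof. by case: (clamp01P x) => -[? ->] //; rewrite /I01 /= ler01 lexx. Qed.

Lemma clamp01_id x : I01 x -> clamp01 x = x.
Proof.
move=> /andP[x0 x1].
by case: (clamp01P x) => -[? ->] //; apply: le_anti; apply/andP.
Qed.

Lemma clamp01_lipschitz x y : `|clamp01 x - clamp01 y| <= `|x - y|.
Proof.
have xy : x - y <= `|x - y| by exact: ler_norm.
have yx : y - x <= `|x - y| by rewrite distrC; exact: ler_norm.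
rewrite /I01 ler_norml; apply/andP.
by case: (clamp01P x) => -[+ ->]; case: (clamp01P y) => -[+ ->];
  do ?[move=> /andP[? ?]|move=> ?]; split; lra.
Qed.

Lemma continuous_clamp01 : continuous clamp01.
Proof.
move=> x; apply/cvgrPdist_lt => e e0; near=> y.
apply: le_lt_trans (clamp01_lipschitz _ _) _.
by near: y; exact: (@cvgr_dist_lt _ _ _ _ _ id x cvg_id).
Unshelve. all: by end_near. Qed.

Lemma cont2_on01_clamp (f : R -> R -> R) : cont2_on01 f ->
  continuous (fun z : R * R => f (clamp01 z.1) (clamp01 z.2)).
Proof.
move=> cf [a t] /=; apply/cvgrPdist_lt => e e0.
have [d d0 H] := cf _ _ (clamp01_in a) (clamp01_in t) e e0.
near=> z; rewrite distrC; apply: H; [exact: clamp01_in|exact: clamp01_in| |].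
- apply: le_lt_trans (clamp01_lipschitz _ _) _; rewrite distrC.
  near: z; apply: (@cvgr_dist_lt _ _ _ _ _ (fst : R * R -> R) a) => //.
  exact: cvg_fst.
- apply: le_lt_trans (clamp01_lipschitz _ _) _; rewrite distrC.
  near: z; apply: (@cvgr_dist_lt _ _ _ _ _ (snd : R * R -> R) t) => //.
  exact: cvg_snd.
Unshelve. all: by end_near. Qed.

Lemma cont2_on01_comp (f : R -> R -> R) (g h : R -> R) : cont2_on01 f ->
  continuous g -> continuous h ->
  continuous (fun x => f (clamp01 (g x)) (clamp01 (h x))).
Proof.
move=> cf cg ch x.
have H := cont2_on01_clamp f cf (g x, h x).
apply: (@continuous2_cvg _ _ _ _ (nbhs x) _ g h
  (fun a t => f (clamp01 a) (clamp01 t)) (g x) (h x)).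
- exact: H.
- exact: cg.
- exact: ch.
Qed.

Lemma IVT01 (f : R -> R) x y : I01 x -> I01 y -> x <= y ->
  continuous (f \o clamp01) -> (f x <= 0 <= f y \/ f y <= 0 <= f x) ->
  exists2 c, I01 c & x <= c <= y /\ f c = 0.
Proof.
move=> Ix Iy xy cf H.
have [c] : exists2 c, c \in `[x, y] & (f \o clamp01) c = 0.
  apply: IVT => //; first exact: continuous_subspaceT.
  rewrite /= !clamp01_id //.
  rewrite ge_min le_max.
  by case: H => /andP[-> ->]; rewrite ?orbT.
rewrite in_itv /= => /andP[xc cy].
have Ic : I01 c.
  by move: Ix Iy => /andP[? ?] /andP[? ?]; apply/andP; split; lra.
by rewrite clamp01_id // => fc0; exists c => //; split => //; apply/andP; split.
Qed.

Lemma continuous_eps (f : R -> R) : continuous f -> forall x e, 0 < e ->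
  exists2 d : R, 0 < d & forall y, `|y - x| < d -> `|f y - f x| < e.
Proof.
move=> cf x e e0; have /cvgrPdist_lt/(_ e e0)[d /= d0 H] := cf x.
by exists d => // y yx; rewrite distrC; apply: H; rewrite /= distrC.
Qed.

Lemma deriv01_eps (f : R -> R) x l : deriv01 f x l -> forall e, 0 < e ->
  exists2 d : R, 0 < d & forall b, I01 b -> b != x -> `|b - x| < d ->
    `|(f b - f x) / (b - x) - l| < e.
Proof.
move=> /cvgrPdist_lt fl e e0; have [d /= d0 H] := fl e e0.
exists d => // b Ib bx bd; rewrite distrC; apply: (H b) => //=.
by rewrite distrC.
Qed.

Lemma deriv01_sign (f : R -> R) x l : deriv01 f x l -> f x = 0 -> l < 0 ->
  exists2 d : R, 0 < d & forall b, I01 b -> b != x -> `|b - x| < d ->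
    f b / (b - x) < 0.
Proof.
move=> fl fx l0.
have Nl0 : 0 < - l by rewrite oppr_gt0.
have [d d0 H] := deriv01_eps _ _ _ fl _ Nl0.
exists d => // b Ib bx bd.
by have := H b Ib bx bd; rewrite fx subr0 => /ltr_normlP[_ ?]; lra.
Qed.

(** Every zero is crossed downwards. From a zero one moves slightly right to a negative value; from
    a negative value, a first later point with [0 <= f] would be approached from the left by
    positive values, against its being first. *)
Lemma strict_downcrossing (f g : R -> R) :
  continuous (f \o clamp01) -> (forall a, I01 a -> deriv01 f a (g a)) ->
  (forall a, I01 a -> f a = 0 -> g a < 0) ->
  forall x y, I01 x -> I01 y -> x < y -> f x <= 0 -> f y < 0.
Proof.
move=> cf df gneg.
suff key x y : I01 x -> I01 y -> x < y -> f x < 0 -> f y < 0.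
  move=> x y Ix Iy xy; rewrite le_eqVlt => /orP[/eqP fx0|]; last exact: key.
  have [d d0 H] := deriv01_sign _ _ _ (df x Ix) fx0 (gneg x Ix fx0).
  pose b := Order.min y (x + d / 2).
  have [xb by_ bd] : [/\ x < b, b <= y & b < x + d].
    by rewrite /b; case: (leP y (x + d / 2)) => ?; split; lra.
  have Ib : I01 b.
    by move: Ix Iy => /andP[? ?] /andP[? ?]; apply/andP; split; lra.
  have bx0 : 0 < b - x by lra.
  have fb : f b < 0.
    have := H b Ib; rewrite gt_eqF// gtr0_norm// => /(_ isT).
    rewrite pmulr_llt0 ?invr_gt0//; apply; lra.
  by move: by_; rewrite le_eqVlt => /orP[/eqP <-//|by_]; exact: (key b).
move=> Ix Iy xy fx0; rewrite ltNge; apply/negP => fy0.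
have fc s : I01 s -> forall e, 0 < e -> exists2 d : R, 0 < d &
    forall b, I01 b -> `|b - s| < d -> `|f b - f s| < e.
  move=> Is e e0; have [d d0 H] := continuous_eps _ cf s _ e0.
  by exists d => // b Ib /H /=; rewrite !clamp01_id.
pose S := [set s | x <= s <= y /\ 0 <= f s].
have Sy : S y by split => //; apply/andP; split => //; exact: ltW.
have SI s : x <= s <= y -> I01 s.
  move: Ix Iy => /andP[? ?] /andP[? ?] /andP[? ?]; apply/andP; split; lra.
have lbS : lbound S x by move=> s [/andP[]].
have hS : has_inf S by split; [exists y|exists x].
have Sz := inf_lbound hS.2.
pose z := inf S.
have xz : x <= z by apply: lb_le_inf => //; exists y.
have zy : z <= y by exact: Sz.
have Iz : I01 z by apply: SI; apply/andP.
have approx e : 0 < e -> exists2 s, S s & s < z + e by move=> e0; exact: inf_adherent.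
have fz : 0 <= f z.
  rewrite leNgt; apply/negP => fz.
  have [d d0 H] := fc z Iz (- f z) ltac:(lra).
  have [s Ss sz] := approx d d0.
  have zs : z <= s by exact: Sz.
  have /ltr_normlP[_] := H s (SI s Ss.1) ltac:(rewrite ger0_norm; lra).
  by case: Ss => _ ?; lra.
have xz' : x < z by rewrite lt_neqAle xz andbT; apply/eqP => xz'; move: fx0 fz; rewrite -xz' => ? ?; lra.
(* If [f z = 0] the negative derivative makes [f] positive just to the left; if [f z > 0] continuity
   does. *)
have [d d0 H] : exists2 d : R, 0 < d & forall b, I01 b -> z - d < b < z -> 0 < f b.
  move: fz; rewrite le_eqVlt => /orP[/eqP/esym fz|fz].
    have [d d0 H] := deriv01_sign _ _ _ (df z Iz) fz (gneg z Iz fz).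
    exists d => // b Ib /andP[zb bz].
    have := H b Ib; rewrite lt_eqF// ltr0_norm; last by lra.
    move=> /(_ isT ltac:(lra)).
    by rewrite nmulr_llt0// invr_lt0; lra.
  have [d d0 H] := fc z Iz _ fz.
  exists d => // b Ib /andP[zb bz].
  have /ltr_normlP[] := H b Ib ltac:(rewrite ltr0_norm; lra).
  by lra.
pose b := Order.max x (z - d / 2).
have [xb bz bd] : [/\ x <= b, b < z & z - d < b].
  by rewrite /b; case: (leP x (z - d / 2)) => ?; split; lra.
have Sb : S b.
  have xby : x <= b <= y by apply/andP; split => //; lra.
  by split => //; apply/ltW/H; [exact: SI|apply/andP].
by have := Sz b Sb; rewrite leNgt bz.
Qed.

(** The intermediate point is located by a distance rather than by an interval, so the lemma can be
    used without knowing on which side of [x] the point [y] lies. *)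
Lemma deriv01_MVT (f g : R -> R) : continuous (f \o clamp01) ->
  (forall a, I01 a -> deriv01 f a (g a)) ->
  forall x y, I01 x -> I01 y ->
  exists2 c, I01 c & `|c - x| <= `|y - x| /\ f y - f x = g c * (y - x).
Proof.
move=> cf df.
have key x y : I01 x -> I01 y -> x < y ->
    exists2 c, x < c < y & f y - f x = g c * (y - x).
  move=> Ix Iy xy.
  have [||c cxy] := @MVT _ (f \o clamp01) g x y xy.
  - move=> c; rewrite in_itv /= => /andP[xc cy].
    have Ic : I01 c.
      by move: Ix Iy => /andP[? ?] /andP[? ?]; apply/andP; split; lra.
    have c0 : 0 < c by case/andP: Ix => ? _; lra.
    have c1 : c < 1 by case/andP: Iy => _ ?; lra.
    (* At an interior point a small increment stays in [0,1], so the derivative relative to [0,1] is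
       the ordinary derivative of [f \o clamp01]. *)
    have fD : (fun h : R => h^-1 *: ((f \o clamp01) (h *: 1 + c) - (f \o clamp01) c))
       @ 0^' --> g c.
      apply/cvgrPdist_lt => e e0.
      have [d d0 H] := deriv01_eps _ _ _ (df c Ic) _ e0.
      near=> h.
      have hd : `|h| < d.
        by near: h; apply: dnbhs0_lt.
      have h0 : h != 0 by near: h; exact: nbhs_dnbhs_neq.
      have hc : `|h| < c by near: h; exact: dnbhs0_lt.
      have hc1 : `|h| < 1 - c by near: h; apply: dnbhs0_lt; lra.
      have Ihc : I01 (h + c).
        by move/ltr_normlP: hc => [? ?]; move/ltr_normlP: hc1 => [? ?]; apply/andP; split; lra.
      have := H (h + c) Ihc; rewrite -subr_eq0 addrK => /(_ h0 hd).
      by rewrite /GRing.scale /= mulr1 !clamp01_id// [h^-1 * _]mulrC distrC.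
    split; first by apply/cvg_ex; exists (g c).
    exact/cvg_lim.
  - exact: continuous_subspaceT.
  by move: cxy; rewrite in_itv /= !clamp01_id// => cxy fE; exists c.
move=> x y Ix Iy.
have [xy|yx|<-] := ltgtP x y; last by exists x => //; split => //; ring.
  have [c /andP[xc cy] fE] := key _ _ Ix Iy xy.
  exists c; first by move: Ix Iy => /andP[? ?] /andP[? ?]; apply/andP; split; lra.
  by split => //; rewrite !gtr0_norm; lra.
have [c /andP[xc cy] fE] := key _ _ Iy Ix yx.
exists c; first by move: Ix Iy => /andP[? ?] /andP[? ?]; apply/andP; split; lra.
split; last by rewrite -opprB fE; ring.
by rewrite !ltr0_norm; lra.
Unshelve. all: by end_near. Qed.

Lemma I01_0 : I01 (0 : R). Proof. by rewrite /I01 /= lexx ler01. Qed.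
Lemma I01_1 : I01 (1 : R). Proof. by rewrite /I01 /= lexx ler01. Qed.

Lemma I01_itv : @I01 R = [set` `[0 : R, 1]].
Proof. by apply/seteqP; split => x; rewrite /I01 /= in_itv. Qed.

Lemma measurable_I01 : measurable (@I01 R).
Proof. by rewrite I01_itv; exact: measurable_itv. Qed.

Lemma cont2_on01_l (f : R -> R -> R) t : cont2_on01 f -> I01 t ->
  continuous ((f^~ t) \o clamp01).
Proof.
move=> cf It.
have := cont2_on01_comp _ idfun (cst t) cf (fun=> cvg_id) (fun=> cvg_cst _).
rewrite /cst clamp01_id//; exact.
Qed.

Lemma cont2_on01_r (f : R -> R -> R) a : cont2_on01 f -> I01 a ->
  continuous (f a \o clamp01).
Proof.
move=> cf Ia.
have := cont2_on01_comp _ (cst a) idfun cf (fun=> cvg_cst _) (fun=> cvg_id).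
rewrite /cst clamp01_id//; exact.
Qed.

Lemma within_I01_continuousP (f : R -> R) :
  {within @I01 R, continuous f} <-> continuous (f \o clamp01).
Proof.
split=> [/subspace_continuousP cf x|cf].
  apply/cvgrPdist_lt => e e0.
  have /cvgrPdist_lt/(_ e e0)[d /= d0 H] := cf _ (clamp01_in x).
  near=> y; apply: H => /=; last exact: clamp01_in.
  apply: le_lt_trans (clamp01_lipschitz _ _) _.
  by near: y; exact: (@cvgr_dist_lt _ _ _ _ _ id x cvg_id).
apply: (@subspace_eq_continuous _ _ _ (f \o clamp01)).
  by move=> x; rewrite inE => Ix; rewrite /= clamp01_id.
exact: continuous_subspaceT.
Unshelve. all: by end_near. Qed.

(** Preimages under [f] of open rays at level [a] are rays ending at [g a], hence relatively open.
    The pair will be [astar_pt u] and [thetastar u], in both orders. *)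
Lemma galois_continuous (f g : R -> R) :
  (forall t, I01 t -> I01 (f t)) ->
  (forall a t, I01 a -> I01 t -> (f t < a) = (t < g a)) ->
  (forall a t, I01 a -> I01 t -> (a < f t) = (g a < t)) ->
  continuous (f \o clamp01).
Proof.
move=> fI fl fr x; apply/cvgrPdist_lt => e e0.
suff [d d0 H] : exists2 d, 0 < d & forall y, I01 y ->
    `|y - clamp01 x| < d -> `|f y - f (clamp01 x)| < e.
  near=> y; rewrite distrC /=; apply: H; first exact: clamp01_in.
  apply: le_lt_trans (clamp01_lipschitz _ _) _; rewrite distrC.
  by near: y; exact: (@cvgr_dist_lt _ _ _ _ _ id x cvg_id).
move: (clamp01 x) (clamp01_in x) => {}x Ix.
have /andP[fx0 fx1] := fI x Ix.
have [d1 d10 H1] : exists2 d, 0 < d & forall y, I01 y -> y < x + d -> f y < f x + e.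
  (* The equivalences speak only of levels in [0,1]; a level above 1 bounds [f] for free. *)
  have [big|small] := ltP 1 (f x + e / 2).
    exists 1 => // y Iy _; have /andP[_ ?] := fI y Iy; lra.
  have Ia : I01 (f x + e / 2) by apply/andP; split; lra.
  have xg : x < g (f x + e / 2) by rewrite -fl//; lra.
  exists (g (f x + e / 2) - x); first by rewrite subr_gt0.
  move=> y Iy yd; apply: (@lt_trans _ _ (f x + e / 2)); last by lra.
  by rewrite fl//; lra.
have [d2 d20 H2] : exists2 d, 0 < d & forall y, I01 y -> x - d < y -> f x - e < f y.
  have [big|small] := ltP (f x - e / 2) 0.
    exists 1 => // y Iy _; have /andP[? _] := fI y Iy; lra.
  have Ia : I01 (f x - e / 2) by apply/andP; split; lra.
  have xg : g (f x - e / 2) < x by rewrite -fr//; lra.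
  exists (x - g (f x - e / 2)); first by rewrite subr_gt0.
  move=> y Iy yd; apply: (@lt_trans _ _ (f x - e / 2)); first by lra.
  by rewrite fr//; lra.
exists (Order.min d1 d2); first by rewrite lt_min d10.
move=> y Iy; rewrite lt_min => /andP[/ltr_normlP[? ?] /ltr_normlP[? ?]].
have ? := H1 y Iy ltac:(lra).
have ? := H2 y Iy ltac:(lra).
by apply/ltr_normlP; split; lra.
Unshelve. all: by end_near. Qed.

(** Extends an inequality to the extreme actions 0 and 1, at which two-sided arguments break
    down. *)
Lemma continuous_le_I01 (f : R -> R) c : continuous (f \o clamp01) ->
  (forall x, 0 < x < 1 -> f x <= c) -> forall x, I01 x -> f x <= c.
Proof.
move=> cf H x Ix; rewrite leNgt; apply/negP => cfx.
have [d d0 dP] := continuous_eps _ cf x (f x - c) ltac:(lra).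
have [y xy ydx] : exists2 y : R, 0 < y < 1 & `|y - x| < d.
  case/andP: Ix => x0 x1.
  (* A move of at most 1/4 towards the midpoint from any point of [0,1] ends in the open
     interval. *)
  pose m := Order.min (d / 2) (1 / 4).
  have [m0 m4 md] : [/\ 0 < m, m <= 1 / 4 & m < d].
    by rewrite /m; case: (leP (d / 2) (1 / 4)) => ?; split; lra.
  have [x2|x2] := leP x (1 / 2).
    by exists (x + m); [apply/andP; split; lra|rewrite ger0_norm; lra].
  by exists (x - m); [apply/andP; split; lra|rewrite ler0_norm; lra].
have Iy : I01 y by case/andP: xy => ? ?; apply/andP; split; lra.
have := dP y ydx; rewrite /= !clamp01_id// => /ltr_normlP[? _].
have := H y xy; lra.
Qed.

Lemma clamp01_bounded2 (g : R * R -> R) : continuous g ->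
  exists M, forall z, `|g (clamp01 z.1, clamp01 z.2)| <= M.
Proof.
move=> cg.
have cK : compact ((@I01 R) `*` (@I01 R)).
  by apply: compact_setX; rewrite I01_itv; exact: segment_compact.
have /compact_bounded[M [_ H]] : compact (g @` ((@I01 R) `*` (@I01 R))).
  by apply: continuous_compact => //; exact: continuous_subspaceT.
exists (M + 1) => z; apply: H; first by rewrite ltrDl.
by exists (clamp01 z.1, clamp01 z.2) => //; split; exact: clamp01_in.
Qed.

Lemma clamp01_bounded (f : R -> R) : continuous (f \o clamp01) ->
  exists M, forall x, `|f (clamp01 x)| <= M.
Proof.
move=> cf; have [M H] : exists M, forall z : R * R,
    `|(f \o clamp01 \o fst) (clamp01 z.1, clamp01 z.2)| <= M.
  apply: clamp01_bounded2 => z; apply: continuous_comp; first exact: cvg_fst.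
  exact: cf.
exists M => x; have := H (x, x).
by rewrite /= (clamp01_id (clamp01 x))//; exact: clamp01_in.
Qed.

End Clamp.

(** * Functions on the unit square, full support and marginals *)

Section Square.
Context {R : realType}.
Local Notation I01 := (@I01 R).

Lemma measurable_square : measurable (I01 `*` I01).
Proof. by apply: measurableX; exact: measurable_I01. Qed.

(** For [f] continuous on the square this is a continuous, bounded extension to the plane, hence
    measurable and integrable against every outcome. *)
Definition clamp2 (f : R -> R -> R) (z : R * R) : R :=
  f (clamp01 z.1) (clamp01 z.2).

Lemma clamp2_measurable f : cont2_on01 f -> measurable_fun setT (clamp2 f).
Proof. by move=> cf; apply: continuous_measurable_plane; exact: cont2_on01_clamp. Qed.

Lemma clamp2_bounded f : cont2_on01 f -> exists M, forall z, `|clamp2 f z| <= M.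
Proof.
move=> /cont2_on01_clamp/clamp01_bounded2[M H]; exists M => z.
have := H z; rewrite /= (clamp01_id (clamp01 z.1)) ?(clamp01_id (clamp01 z.2))//;
  exact: clamp01_in.
Qed.

Lemma clamp2_id f a t : I01 a -> I01 t -> clamp2 f (a, t) = f a t.
Proof. by move=> Ia It; rewrite /clamp2 /= !clamp01_id. Qed.

Lemma indic_mul_bounded (T : Type) (A : set T) x (y M : R) :
  `|y| <= M -> `|y * \1_A x| <= M.
Proof.
move=> yM; rewrite indicE; case: (_ \in _); rewrite /= ?mulr1// mulr0 normr0.
exact: le_trans yM.
Qed.

Variable phi : probability R R.
Hypothesis supp : supp_is_01 phi.

(** A zero integral would make the set where [f] is nonzero null, yet that set contains a ball
    around a point of the support. *)
Lemma supp_Rintegral_gt0 (f : R -> R) (t d M : R) : I01 t -> 0 < d ->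
  measurable_fun setT f -> (forall x, 0 <= f x <= M) ->
  (forall x, `|x - t| < d -> 0 < f x) -> 0 < \int[phi]_x f x.
Proof.
move=> It d0 mf fM fpos.
rewrite lt_neqAle Rintegral_ge0 ?andbT; last by move=> x _; case/andP: (fM x).
apply/eqP => /esym If0.
have N0 := Rintegral_eq0_null phi _ _ mf fM If0.
have := supp.2 t It d d0; rewrite lt_neqAle => /andP[/eqP H _]; apply: H.
apply/esym; apply: (@subset_measure0 _ _ _ phi _ [set x | f x != 0]) => //.
- rewrite (_ : [set _ | _] = ball t d); last first.
    by apply/seteqP; split => x; rewrite /ball /= distrC.
  by apply: measurable_ball.
- exact: measurable_neq0.
- by move=> x /= /fpos; rewrite lt0r => /andP[].
Qed.

Lemma outcome_marginal (pi : probability (R * R)%type R) : outcome pi ->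
  (forall B : set R, measurable B -> pi (I01 `*` B) = phi B) ->
  forall (f : R -> R) M, measurable_fun setT f -> (forall x, `|f x| <= M) ->
  \int[pi]_z f z.2 = \int[phi]_t f t.
Proof.
move=> opi mpi f M mf fM.
apply/esym; apply: (@Rintegral_pushforward_eq _ _ _ _ _ pi phi snd f M) => //.
move=> E mE; rewrite -mpi//.
apply: (@measure_eq_off_null _ _ _ pi _ _ (~` (I01 `*` I01))).
- by apply: measurableX => //; exact: measurable_I01.
- by rewrite -[X in measurable X]setTI; exact: measurable_snd.
- by apply: measurableC; exact: measurable_square.
- by rewrite probability_setC ?opi ?subee//; exact: measurable_square.
- by apply/seteqP; split => -[x y] /=; rewrite ?notK => -[]; tauto.
Qed.

End Square.

(** * Signs of u, the maps [astar_pt] and [thetastar], and the first-order condition *)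

Section Disclosure.
Context {R : realType}.
Definition fd_price (V u : R -> R -> R) (t : R) : R := V (astar_pt u t) t.

Definition fd_mult (v u ua : R -> R -> R) (a : R) : R :=
  v a (thetastar u a) / (- ua a (thetastar u a)).

Variables V U v u ua : R -> R -> R.
Hypothesis cV : cont2_on01 V.
Hypothesis A1 : assumption1 V U v u ua.
Hypothesis A2 : assumption2 u ua.
Hypothesis A3 : assumption3 u.
Hypothesis A4 : assumption4 u.
Implicit Types a t x y : R.

Let cu : cont2_on01 u := A1.2.2.1.
Let cua : cont2_on01 ua := A1.2.2.2.
Let cv : cont2_on01 v := A1.2.1.

Lemma integral_dirac_I01 (f : R -> R) t : I01 t ->
  continuous (f \o clamp01) ->
  (\int[(\d_t : probability R R)]_(x in @I01 R) (f x)%:E = (f t)%:E)%E.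
Proof.
move=> It cf.
rewrite (_ : (\int[_]_(x in @I01 R) _)%E =
  (\int[(\d_t : probability R R)]_(x in @I01 R) ((f \o clamp01) x)%:E)%E); last first.
  by apply: eq_integral => x; rewrite inE /= => Ix; rewrite clamp01_id.
rewrite integral_dirac; last 2 first.
- exact: measurable_I01.
- apply/measurable_EFinP; apply: measurable_funTS.
  exact: continuous_measurable_fun.
by rewrite diracE mem_set// mul1e /= clamp01_id.
Qed.

(** This is Assumption 2 at the Dirac measure of [t]. *)
Lemma u_zero_ua a t : I01 a -> I01 t -> u a t = 0 -> ua a t < 0.
Proof.
move=> Ia It u0.
have := A2 a Ia (\d_t : probability R R).
rewrite /prob01 /= diracE mem_set// => /(_ erefl).
rewrite !integral_dirac_I01//; [|exact: cont2_on01_r..].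
by rewrite u0 lte_fin; exact.
Qed.

Lemma u_downcrossing t x y : I01 t -> I01 x -> I01 y -> x < y ->
  u x t <= 0 -> u y t < 0.
Proof.
move=> It; apply: (@strict_downcrossing R (u^~ t) (ua^~ t)).
- exact: cont2_on01_l.
- by move=> a Ia; have [_ []] := A1.1 a t Ia It.
- by move=> a Ia; exact: u_zero_ua.
Qed.

Lemma astar_ptP t : I01 t -> I01 (astar_pt u t) /\ u (astar_pt u t) t = 0.
Proof.
move=> It; apply: (@xgetPex _ 0 [set a | I01 a /\ u a t = 0]).
have [c Ic [_ uc]] : exists2 c, I01 c & 0 <= c <= 1 /\ u c t = 0.
  apply: (@IVT01 _ (u^~ t)) => //; [exact: I01_0|exact: I01_1|exact: cont2_on01_l|].
  by right; rewrite (A3.1.1 t It) (A3.2.1 t It).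
by exists c.
Qed.

Lemma u_gt0 a t : I01 a -> I01 t -> (0 < u a t) = (a < astar_pt u t).
Proof.
move=> Ia It; have [Ib ub] := astar_ptP t It.
apply/idP/idP => [ua0|ab].
  rewrite ltNge; apply/negP; rewrite le_eqVlt => /orP[/eqP ab|ab].
    by move: ua0; rewrite -ab ub ltxx.
  have := u_downcrossing t _ _ It Ib Ia ab; rewrite ub lexx => /(_ isT); lra.
rewrite ltNge; apply/negP => /(u_downcrossing t _ _ It Ia Ib ab).
by rewrite ub ltxx.
Qed.

Lemma u_lt0 a t : I01 a -> I01 t -> (u a t < 0) = (astar_pt u t < a).
Proof.
move=> Ia It; have [Ib ub] := astar_ptP t It.
apply/idP/idP => [ua0|ab]; last first.
  by apply: (u_downcrossing t _ _ It Ib Ia ab); rewrite ub.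
rewrite ltNge le_eqVlt; apply/negP => /orP[/eqP ab|].
  by move: ua0; rewrite ab ub ltxx.
by rewrite -u_gt0//; lra.
Qed.

Lemma astar_pt_uniq a t : I01 a -> I01 t -> u a t = 0 -> astar_pt u t = a.
Proof.
move=> Ia It ua0; apply/eqP; rewrite eq_le !leNgt.
by rewrite -u_gt0// -u_lt0// ua0 ltxx.
Qed.

(** Assumption 3 provides only some zero [t] of [u 0]. If [u 0 0] were positive, then at a small
    action [b > 0] u would still be positive at state 0 but already negative at [t]. A zero of [u b]
    in between would contradict single crossing. *)
Lemma u00 : u 0 0 = 0.
Proof.
have [[u0 [t It ut]] _] := A3.
have [I0 I1] := (@I01_0 R, @I01_1 R).
have := u0 0 I0; rewrite le_eqVlt => /orP[/eqP/esym//|u00].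
have t0 : 0 < t.
  rewrite lt_neqAle; case/andP: (It) => -> _; rewrite andbT.
  by apply/eqP => t0; move: u00; rewrite {3}t0 ut ltxx.
have [d d0 H] := continuous_eps _ (cont2_on01_l _ _ cu I0) 0 _ u00.
pose b : R := Order.min 1 (d / 2).
have b0 : 0 < b by rewrite lt_min ltr01/=; lra.
have Ib : I01 b by rewrite /I01 /= ltW// ge_min lexx.
have bd : b < d by rewrite gt_min; apply/orP; right; lra.
have ub0 : 0 < u b 0.
  have := H b; rewrite subr0 gtr0_norm// => /(_ bd) /=.
  by rewrite !clamp01_id// => /ltr_normlP[]; lra.
have ubt : u b t < 0 by apply: (u_downcrossing t 0 b) => //; rewrite ut.
have [c Ic [/andP[c0 ct] uc]] : exists2 c, I01 c & 0 <= c <= t /\ u b c = 0.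
  apply: IVT01 => //; [exact: ltW|exact: cont2_on01_r|by right; rewrite !ltW].
have ct' : c < t.
  by rewrite lt_neqAle ct andbT; apply/eqP => ce; move: ubt; rewrite -ce uc ltxx.
have := A4 b c t Ib Ic It ct' uc; lra.
Qed.

(** Here single crossing suffices: a zero [t < 1] of [u 1] would force [0 < u 1 1]. *)
Lemma u11 : u 1 1 = 0.
Proof.
have [_ [u1 [t It ut]]] := A3.
have [I0 I1] := (@I01_0 R, @I01_1 R).
case/andP: (It) => _; rewrite le_eqVlt => /orP[/eqP t1|t1]; first by move: ut; rewrite t1.
by have := A4 1 t 1 I1 It I1 t1 ut; have := u1 1 I1; lra.
Qed.

Lemma thetastarP a : I01 a -> I01 (thetastar u a) /\ u a (thetastar u a) = 0.
Proof.
move=> Ia; apply: (@xgetPex _ 0 [set t | I01 t /\ u a t = 0]).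
have [I0 I1] := (@I01_0 R, @I01_1 R).
have [c Ic [_ uc]] : exists2 c, I01 c & 0 <= c <= 1 /\ u a c = 0.
  apply: IVT01 => //; first exact: cont2_on01_r.
  left; case/andP: (Ia) => a0 a1; apply/andP; split; rewrite leNgt.
    by rewrite u_gt0// (astar_pt_uniq 0 0 I0 I0 u00) -leNgt.
  by rewrite u_lt0// (astar_pt_uniq 1 1 I1 I1 u11) -leNgt.
by exists c.
Qed.

Lemma astar_ptK a : I01 a -> astar_pt u (thetastar u a) = a.
Proof. by move=> Ia; have [It ut] := thetastarP a Ia; exact: astar_pt_uniq. Qed.

(** Single crossing speaks only to the right of a zero. On the left, [u a 0 <= 0] and a positive
    value would produce an earlier zero, from which single crossing would make u positive at
    [thetastar u a] itself. *)
Lemma u_gt0_thetastar a t : I01 a -> I01 t -> (0 < u a t) = (thetastar u a < t).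
Proof.
move=> Ia It; have [Is us] := thetastarP a Ia.
have [st|ts|<-] := ltgtP (thetastar u a) t; last by rewrite us ltxx.
  exact: (A4 a _ _ Ia Is It st us).
apply/negP => u0.
have [c Ic [/andP[_ ct] uc]] : exists2 c, I01 c & 0 <= c <= t /\ u a c = 0.
  have [I0 I1] := (@I01_0 R, @I01_1 R).
  case/andP: (It) => t0 _.
  apply: IVT01 => //; first exact: cont2_on01_r.
  left; apply/andP; split; last exact: ltW.
  rewrite leNgt u_gt0// (astar_pt_uniq 0 0 I0 I0 u00) -leNgt.
  by case/andP: Ia.
have cs : c < thetastar u a by exact: le_lt_trans ts.
by have := A4 a c _ Ia Ic Is cs uc; rewrite us ltxx.
Qed.

Lemma u_eq0_thetastar a t : I01 a -> I01 t -> u a t = 0 -> t = thetastar u a.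
Proof.
move=> Ia It ut; have [Is us] := thetastarP a Ia.
have [ts|st|//] := ltgtP t (thetastar u a).
  by have := A4 a _ _ Ia It Is ts ut; rewrite us ltxx.
by have := A4 a _ _ Ia Is It st us; rewrite ut ltxx.
Qed.

Lemma u_lt0_thetastar a t : I01 a -> I01 t -> (u a t < 0) = (t < thetastar u a).
Proof.
move=> Ia It; have [Is us] := thetastarP a Ia.
have [ut|ut|ut] := ltgtP (u a t) 0.
- rewrite lt_neqAle leNgt -u_gt0_thetastar// -leNgt ltW// andbT.
  by apply/esym/eqP => ts; move: ut; rewrite ts us ltxx.
- by move: ut; rewrite u_gt0_thetastar// => /ltW; rewrite leNgt => /negbTE ->.
- by rewrite -(u_eq0_thetastar _ _ Ia It ut) ltxx.
Qed.

(** The sign of [u a t] decides both how [a] compares with [astar_pt u t] and how [t] compares with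
    [thetastar u a]; this is the required Galois pair. *)
Lemma astar_pt_continuous : continuous (astar_pt u \o clamp01).
Proof.
apply: (@galois_continuous _ _ (thetastar u)).
- by move=> t It; exact: (astar_ptP t It).1.
- by move=> a t Ia It; rewrite -u_lt0// u_lt0_thetastar.
- by move=> a t Ia It; rewrite -u_gt0// u_gt0_thetastar.
Qed.

Lemma thetastar_continuous : continuous (thetastar u \o clamp01).
Proof.
apply: (@galois_continuous _ _ (astar_pt u)).
- by move=> a Ia; exact: (thetastarP a Ia).1.
- by move=> t a It Ia; rewrite -u_gt0// u_gt0_thetastar.
- by move=> t a It Ia; rewrite -u_lt0// u_lt0_thetastar.
Qed.

Lemma fd_price_continuous : continuous (fd_price V u \o clamp01).
Proof.
rewrite (_ : _ \o clamp01 =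
    fun t => V (clamp01 ((astar_pt u \o clamp01) t)) (clamp01 (clamp01 t))).
  apply: cont2_on01_comp => //; first exact: astar_pt_continuous.
  exact: continuous_clamp01.
apply/funext => t /=; rewrite /fd_price.
have It := clamp01_in t; rewrite (clamp01_id (clamp01 t))//.
by rewrite (clamp01_id (astar_pt _ _))//; exact: (astar_ptP _ It).1.
Qed.

Lemma ua_thetastar_lt0 a : I01 a -> ua a (thetastar u a) < 0.
Proof. by move=> Ia; have [It ut] := thetastarP a Ia; exact: u_zero_ua. Qed.

Lemma thetastar_comp_continuous (f : R -> R -> R) : cont2_on01 f ->
  continuous ((fun a => f a (thetastar u a)) \o clamp01).
Proof.
move=> cf; rewrite (_ : _ \o clamp01 =
    fun a => f (clamp01 (clamp01 a)) (clamp01 ((thetastar u \o clamp01) a))).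
  apply: cont2_on01_comp => //; first exact: continuous_clamp01.
  exact: thetastar_continuous.
apply/funext => a /=.
have Ia := clamp01_in a; rewrite (clamp01_id (clamp01 a))//.
by rewrite (clamp01_id (thetastar _ _))//; exact: (thetastarP _ Ia).1.
Qed.

Lemma fd_mult_continuous : continuous (fd_mult v u ua \o clamp01).
Proof.
move=> a; apply: cvgM; first exact: (thetastar_comp_continuous v cv a).
apply: cvgV.
  by rewrite oppr_eq0 lt_eqF//; exact: ua_thetastar_lt0 (clamp01_in a).
by apply: cvgN; exact: (thetastar_comp_continuous ua cua a).
Qed.

(** By the mean value theorem in the action, the slack at [t] is [(astar_pt u t - a) * (v x t + r *
    ua y t)] with x, y between-points tending to [a] as [t] tends to [s = thetastar u a]. The first
    factor changes sign at [s], so the limit of the second must vanish. Interiority of [a] puts [s]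
    strictly inside [0,1], which leaves room on both sides. *)
Lemma multiplier_first_order a r : 0 < a < 1 ->
  (forall t, I01 t -> V a t + r * u a t <= fd_price V u t) ->
  r = fd_mult v u ua a.
Proof.
move=> /andP[a0 a1] H.
have Ia : I01 a by apply/andP; split; lra.
have [Is us] := thetastarP a Ia; set s := thetastar u a in Is us *.
have uas := ua_thetastar_lt0 a Ia.
have s0 : 0 < s.
  rewrite -u_lt0_thetastar//; last exact: I01_0.
  rewrite u_lt0//; last exact: I01_0.
  by rewrite (astar_pt_uniq 0 0)//; [exact: I01_0..|exact: u00].
have s1 : s < 1.
  rewrite -u_gt0_thetastar//; last exact: I01_1.
  rewrite u_gt0//; last exact: I01_1.
  by rewrite (astar_pt_uniq 1 1)//; [exact: I01_1..|exact: u11].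
have mvt t : I01 t -> exists x y, [/\ I01 x, I01 y,
    `|x - a| <= `|astar_pt u t - a|, `|y - a| <= `|astar_pt u t - a| &
    0 <= (astar_pt u t - a) * (v x t + r * ua y t)].
  move=> It; have [Ib ub] := astar_ptP t It.
  have [x Ix [xa xE]] := deriv01_MVT (V^~ t) (v^~ t) (cont2_on01_l _ _ cV It)
    (fun c Ic => (A1.1 c t Ic It).1) a _ Ia Ib.
  have [y Iy [ya yE]] := deriv01_MVT (u^~ t) (ua^~ t) (cont2_on01_l _ _ cu It)
    (fun c Ic => (A1.1 c t Ic It).2.2) a _ Ia Ib.
  exists x, y; split => //.
  have := H t It; rewrite /fd_price /= in xE yE *.
  rewrite ub in yE.
  have -> : u a t = - (ua y t * (astar_pt u t - a)) by rewrite -yE; ring.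
  have -> : V (astar_pt u t) t = V a t + v x t * (astar_pt u t - a) by rewrite -xE; ring.
  by move=> ?; nra.
have key e : 0 < e -> exists2 d, 0 < d & forall t, I01 t -> `|t - s| < d ->
    t != s -> exists2 k, `|k - (v a s + r * ua a s)| < e & 0 <= (astar_pt u t - a) * k.
  move=> e0.
  have [d1 d10 H1] := cv _ _ Ia Is (e / 2) ltac:(lra).
  have r0 : 0 < 1 + `|r| by rewrite ltr_pwDl.
  (* The divisor absorbs the factor r of the [ua] term; adding 1 keeps it positive when r = 0. *)
  have [d2 d20 H2] := cua _ _ Ia Is (e / 2 / (1 + `|r|)) ltac:(apply: divr_gt0 => //; lra).
  have [d3 d30 H3] := continuous_eps _ astar_pt_continuous s (Order.min d1 d2) ltac:(by rewrite lt_min d10).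
  exists (Order.min d3 (Order.min d1 d2)); first by rewrite !lt_min d10 d20 d30.
  move=> t It; rewrite !lt_min => /and3P[td3 td1 td2] ts.
  have [x [y [Ix Iy xa ya kE]]] := mvt t It.
  have := H3 t td3; rewrite /= !clamp01_id// astar_ptK// lt_min => /andP[b1 b2].
  exists (v x t + r * ua y t) => //.
  have ? := H1 x t Ix It (le_lt_trans xa b1) td1.
  have B := H2 y t Iy It (le_lt_trans ya b2) td2.
  have -> : v x t + r * ua y t - (v a s + r * ua a s) =
    (v x t - v a s) + r * (ua y t - ua a s) by ring.
  apply: le_lt_trans (ler_normD _ _) _; rewrite normrM.
  have : (1 + `|r|) * `|ua y t - ua a s| < e / 2.
    by rewrite mulrC -ltr_pdivlMr.
  rewrite mulrDl mul1r; have := normr_ge0 (ua y t - ua a s); lra.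
suff L0 : v a s + r * ua a s = 0.
  have nz : - ua a s != 0 by rewrite oppr_eq0 lt_eqF.
  by apply: (mulIf nz); rewrite /fd_mult -/s divfK//; lra.
apply/eqP; rewrite -normr_eq0; apply/eqP/le_anti; rewrite normr_ge0 andbT leNgt.
apply/negP => e0.
(* With the tolerance equal to the modulus of the limit, both nearby values [kp] and [km] inherit
   its strict sign, although [km <= 0 <= kp]. *)
have [d d0 dP] := key _ e0.
pose m := Order.min (d / 2) (Order.min (s / 2) ((1 - s) / 2)).
have m0 : 0 < m by rewrite !lt_min; apply/and3P; split; lra.
have md : m <= d / 2 by rewrite ge_min lexx.
have ms : m <= s / 2 by rewrite !ge_min lexx orbT.
have ms1 : m <= (1 - s) / 2 by rewrite !ge_min lexx !orbT.
have Ip : I01 (s + m) by apply/andP; split; lra.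
have Im : I01 (s - m) by apply/andP; split; lra.
have [kp kpd kp0] := dP (s + m) Ip ltac:(rewrite ger0_norm; lra) ltac:(apply/eqP; lra).
have [km kmd km0] := dP (s - m) Im ltac:(rewrite ler0_norm; lra) ltac:(apply/eqP; lra).
have bp : a < astar_pt u (s + m) by rewrite -u_gt0// u_gt0_thetastar// -/s; lra.
have bm : astar_pt u (s - m) < a by rewrite -u_lt0// u_lt0_thetastar// -/s; lra.
have kp1 : 0 <= kp by move: kp0; rewrite pmulr_rge0// subr_gt0.
have km1 : km <= 0 by move: km0; rewrite nmulr_rge0// subr_lt0.
move: kpd kmd => /ltr_normlP[] + + /ltr_normlP[].
by have [/ger0_norm ->|/ltr0_norm ->] := leP 0 (v a s + r * ua a s); lra.
Qed.

(** Masses [u a t2] at [t1] and [- u a t1] at [t2] satisfy obedience at [a] exactly; the left-hand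
    side is the sender's gain from pooling them there instead of disclosing. Dividing by
    [- u a t1 * u a t2] gives the separation of slopes. *)
Definition pairwise_disclosure : Prop := forall a t1 t2,
  I01 a -> I01 t1 -> I01 t2 -> u a t1 < 0 -> 0 < u a t2 ->
  (V a t1 - fd_price V u t1) * u a t2 - (V a t2 - fd_price V u t2) * u a t1 <= 0.

(** * Outcomes as integrals, and pooling deviations from disclosure *)

Local Notation I01 := (@I01 R).

Variable phi : probability R R.
Hypothesis supp : supp_is_01 phi.

Lemma obedience_integralE (pi : probability (R * R)%type R) (B : set R) :
  outcome pi -> measurable B ->
  (\int[pi]_(z in (B `&` I01) `*` I01) (u z.1 z.2)%:E =
   (\int[pi]_z (clamp2 u z * \1_B z.1))%:E)%E.
Proof.
move=> opi mB; have [M uM] := clamp2_bounded u cu.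
rewrite (_ : (B `&` I01) `*` I01 = (I01 `*` I01) `&` (fst @^-1` B)); last first.
  by apply/seteqP; split => -[a t] /=; tauto.
rewrite integral_mkcondr.
under eq_integral do rewrite restrict_EFin.
apply: (@Rintegral_full _ _ _ _ _ _ _ M) => //.
- exact: measurable_square.
- apply: measurable_funM; first exact: clamp2_measurable.
  by apply: (@measurableT_comp _ _ _ _ _ _ (\1_B : R -> R)) => //; exact: measurable_indic.
- by move=> z; exact: indic_mul_bounded.
- move=> [a t] [/= Ia It]; rewrite /patch clamp2_id// indicE /=.
  have -> : ((a, t) \in fst @^-1` B) = (a \in B) by apply/idP/idP; rewrite !inE.
  by case: (_ \in _); rewrite ?mulr1 ?mulr0.
Qed.

Lemma sender_valueE (pi : probability (R * R)%type R) : outcome pi ->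
  sender_value V pi = (\int[pi]_z clamp2 V z)%:E.
Proof.
move=> opi; have [M VM] := clamp2_bounded V cV.
apply: (@Rintegral_full _ _ _ _ _ _ _ M) => //.
- exact: measurable_square.
- exact: clamp2_measurable.
- by move=> [a t] [/= Ia It]; rewrite clamp2_id.
Qed.

Definition fd_map t : R * R := (astar_pt u (clamp01 t), t).

Lemma astar_clamp_measurable : measurable_fun setT (astar_pt u \o clamp01).
Proof. exact: continuous_measurable_fun astar_pt_continuous. Qed.

Lemma fd_map_measurable : measurable_fun setT fd_map.
Proof.
by apply: measurable_fun_pair; [exact: astar_clamp_measurable|exact: measurable_id].
Qed.

(* [full_disclosure] uses the unclamped map, which need not be measurable
   outside [0,1], so the preimages there may receive junk values from [phi]. *)
Lemma full_disclosureE (pifd : probability (R * R)%type R) :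
  full_disclosure phi u pifd ->
  forall E, measurable E -> pifd E = phi (fd_map @^-1` E).
Proof.
move=> fd E mE.
have mI : measurable I01 by exact: measurable_I01.
have mN : measurable (setT `*` ~` I01 : set (R * R)).
  by apply: measurableX => //; exact: measurableC.
have mS : measurable (setT `*` I01 : set (R * R)) by exact: measurableX.
have phi0 : phi (~` I01) = 0%E by rewrite probability_setC// supp.1 subee.
have mfE : measurable (fd_map @^-1` E).
  by rewrite -[X in measurable X]setTI; exact: fd_map_measurable.
rewrite (@measure_eq_off_null _ _ _ pifd E (E `&` (setT `*` I01)) _ _ _ mN)//.
- rewrite fd; last exact: measurableI.
  have -> : (fun t => (astar_pt u t, t)) @^-1` (E `&` (setT `*` I01)) =
      fd_map @^-1` E `&` I01.
    apply/seteqP; split => t /=.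
      by move=> [Et [_ It]]; rewrite /fd_map clamp01_id.
    by move=> [Et It]; move: Et; rewrite /fd_map clamp01_id.
  apply: (@measure_eq_off_null _ _ _ phi _ _ (~` I01)) => //.
  + exact: measurableI.
  + exact: measurableC.
  + by rewrite !setDE !setCK -setIA setIid.
- exact: measurableI.
- rewrite fd// -phi0; congr (phi _).
  by apply/seteqP; split => t; [move=> [_]|].
- apply/seteqP; split => -[a t] /=; last by move=> [[]].
  move=> [Ez NI]; split=> //; split=> //; split=> //.
  by apply: contrapT => It; apply: NI.
Qed.

Lemma full_disclosure_value (pifd : probability (R * R)%type R) :
  full_disclosure phi u pifd ->
  \int[pifd]_z clamp2 V z = \int[phi]_t fd_price V u (clamp01 t).
Proof.
move=> fd; have [M VM] := clamp2_bounded V cV.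
rewrite (@Rintegral_pushforward_eq _ _ _ _ _ phi pifd fd_map _ M)//.
- apply: eq_Rintegral => t _; rewrite /clamp2 /fd_price /= clamp01_id//.
  exact: (astar_ptP _ (clamp01_in t)).1.
- exact: fd_map_measurable.
- exact: clamp2_measurable.
- exact: full_disclosureE.
Qed.

Definition pool_map (a : R) (N : set R) t : R * R :=
  (if t \in N then a else astar_pt u (clamp01 t), t).

Lemma pool_map_measurable a N : measurable N -> measurable_fun setT (pool_map a N).
Proof.
move=> mN; apply: measurable_fun_pair => //.
apply: measurable_fun_ifT.
- by apply: (measurable_fun_bool true); rewrite setTI; rewrite (_ : _ @^-1` _ = N) //;
    apply/seteqP; split => x /= xN; [exact: set_mem|exact: mem_set].
- exact: measurable_cst.
- exact: astar_clamp_measurable.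
Qed.

(* Mixing two pooling maps with weights c and 1 - c moves the measure
   c phi|N1 + (1 - c) phi|N2 to the action a and discloses everything else. *)
Lemma pooled_outcome a (N1 N2 : set R) (c : R) :
  measurable N1 -> measurable N2 -> 0 <= c <= 1 ->
  exists pi : probability (R * R)%type R,
  (forall E, pi E = c%:E * phi (pool_map a N1 @^-1` E) +
                    (1 - c)%:E * phi (pool_map a N2 @^-1` E))%E /\
  (forall (f : R * R -> R) M, measurable_fun setT f -> (forall z, `|f z| <= M) ->
    \int[pi]_z f z = c * \int[phi]_t f (pool_map a N1 t) +
                     (1 - c) * \int[phi]_t f (pool_map a N2 t)).
Proof.
move=> mN1 mN2 /andP[c0 c1]; have c1' : 0 <= 1 - c by rewrite subr_ge0.
have mp1 := pool_map_measurable a _ mN1; have mp2 := pool_map_measurable a _ mN2.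
pose X1 : {mfun R >-> (R * R)%type} := MeasurableFun.Pack
  (MeasurableFun.Class (isMeasurableFun.Build _ _ _ _ _ mp1)).
pose X2 : {mfun R >-> (R * R)%type} := MeasurableFun.Pack
  (MeasurableFun.Class (isMeasurableFun.Build _ _ _ _ _ mp2)).
have cc : (NngNum c0)%:num + (NngNum c1')%:num = 1 :> R by rewrite /= addrC subrK.
exists (mixture (distribution phi X1) (distribution phi X2) _ _ cc); split.
  by move=> E; exact: (@mixtureE _ _ _ _ _ _ _ cc).
move=> f M mf fM; rewrite (Rintegral_mixture _ _ _ _ _ _ M)//=.
by congr (_ * _ + _ * _); apply: (@Rintegral_pushforward_eq _ _ _ _ _ phi _ _ _ M).
Qed.

Lemma pool_clamp2 (f : R -> R -> R) a N t : I01 a ->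
  clamp2 f (pool_map a N t) =
  (f a (clamp01 t) - f (astar_pt u (clamp01 t)) (clamp01 t)) * \1_N t +
  f (astar_pt u (clamp01 t)) (clamp01 t).
Proof.
move=> Ia; rewrite /clamp2 /pool_map /= indicE.
have [Ib _] := astar_ptP _ (clamp01_in t).
by case: (t \in N); rewrite (clamp01_id _ Ia, clamp01_id _ Ib) ?mulr1 ?mulr0 ?add0r ?subrK.
Qed.

Lemma slice_measurable_bounded (f : R -> R -> R) a : cont2_on01 f -> I01 a ->
  measurable_fun setT (f a \o clamp01) /\ exists M, forall t, `|f a (clamp01 t)| <= M.
Proof.
move=> cf Ia; have cfa := cont2_on01_r f a cf Ia; split.
  exact: continuous_measurable_fun.
exact: clamp01_bounded cfa.
Qed.

(** Disclosed states contribute nothing to obedience, since u vanishes at the disclosed action. Only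
    the states sent to [a] remain, and for them the balance equation is the whole condition. *)
Lemma pool_implementable a (N1 N2 : set R) (c : R) : I01 a ->
  measurable N1 -> measurable N2 -> 0 <= c <= 1 ->
  c * \int[phi]_t (u a (clamp01 t) * \1_N1 t) +
  (1 - c) * \int[phi]_t (u a (clamp01 t) * \1_N2 t) = 0 ->
  exists2 pi, implementable phi u pi & sender_value V pi =
   (\int[phi]_t fd_price V u (clamp01 t) +
     (c * \int[phi]_t ((V a (clamp01 t) - fd_price V u (clamp01 t)) * \1_N1 t) +
     (1 - c) * \int[phi]_t ((V a (clamp01 t) - fd_price V u (clamp01 t)) * \1_N2 t)))%:E.
Proof.
move=> Ia mN1 mN2 c01 balance.
have [pi [piE piI]] := pooled_outcome a _ _ _ mN1 mN2 c01.
have mI : measurable I01 by exact: measurable_I01.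
have pre N (B C : set R) : B a -> (forall x, I01 x -> B x) ->
    pool_map a N @^-1` (B `*` C) = C.
  move=> Ba BI; apply/seteqP; split => t /=; first by case.
  move=> Ct; split => //; case: (_ \in _) => //.
  by apply: BI; exact: (astar_ptP _ (clamp01_in t)).1.
have marg (C : set R) : measurable C -> pi (I01 `*` C) = phi C.
  move=> mC; case/andP: c01 => c0 c1.
  rewrite piE (pre N1 I01 C)// (pre N2 I01 C)//.
  rewrite -ge0_muleDl ?lee_fin ?subr_ge0//.
  by rewrite (_ : (c%:E + (1 - c)%:E)%E = 1%E) ?mul1e// -EFinD addrC subrK.
have opi : outcome pi by rewrite /outcome marg// supp.1.
have [Mu uM] := clamp2_bounded u cu.
have [MV VM] := clamp2_bounded V cV.
have [mua [Mua uaM]] := slice_measurable_bounded u a cu Ia.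
have [mVa [MVa VaM]] := slice_measurable_bounded V a cV Ia.
have mps := continuous_measurable_fun fd_price_continuous.
have [Mps psM] := clamp01_bounded _ fd_price_continuous.
exists pi.
  split => //; split => // B mB.
  rewrite obedience_integralE//; congr EFin.
  rewrite (piI _ Mu); last 2 first.
  - apply: measurable_funM; first exact: clamp2_measurable.
    by apply: (@measurableT_comp _ _ _ _ _ _ (\1_B : R -> R)) => //; exact: measurable_indic.
  - by move=> z; exact: indic_mul_bounded.
  have EN N : measurable N -> \int[phi]_t (clamp2 u (pool_map a N t) * \1_B (pool_map a N t).1) =
      \1_B a * \int[phi]_t (u a (clamp01 t) * \1_N t).
    move=> mN; rewrite -RintegralZl//; last first.
      apply: (@probability_integrable _ _ _ _ _ Mua).
        by apply: measurable_funM => //; exact: measurable_indic.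
      by move=> t; exact: indic_mul_bounded.
    apply: eq_Rintegral => t _; rewrite pool_clamp2//.
    have [_ ->] := astar_ptP _ (clamp01_in t).
    rewrite /pool_map /= [\1_N t]indicE; case: (t \in N); rewrite /= ?mulr1n ?mulr0n; last first.
      by rewrite !mulr0 addr0 mul0r.
    by rewrite !mulr1 subr0 addr0 mulrC.
  rewrite !EN// (_ : _ + _ = \1_B a *
    (c * \int[phi]_t (u a (clamp01 t) * \1_N1 t) +
     (1 - c) * \int[phi]_t (u a (clamp01 t) * \1_N2 t))); last by ring.
  by rewrite balance mulr0.
rewrite sender_valueE//; congr EFin.
rewrite (piI _ MV) => //; last exact: clamp2_measurable.
have EN N : measurable N -> \int[phi]_t clamp2 V (pool_map a N t) =
    \int[phi]_t ((V a (clamp01 t) - fd_price V u (clamp01 t)) * \1_N t) +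
    \int[phi]_t fd_price V u (clamp01 t).
  move=> mN; rewrite -RintegralD//; last 2 first.
  - apply: (@probability_integrable _ _ _ _ _ (MVa + Mps)).
      apply: measurable_funM; last exact: measurable_indic.
      by apply: measurable_funB; [exact: mVa|exact: mps].
    move=> t; apply: indic_mul_bounded; apply: le_trans (ler_normB _ _) _.
    by apply: lerD; [exact: VaM|exact: psM].
  - by apply: (@probability_integrable _ _ _ _ _ Mps).
  by apply: eq_Rintegral => t _; rewrite pool_clamp2.
by rewrite !EN//; ring.
Qed.

Lemma Rintegral_restrict_gt0 (g : R -> R) (N : set R) (t d M : R) : I01 t ->
  0 < d -> measurable_fun setT g -> (forall x, `|g x| <= M) -> measurable N ->
  (forall x, N x -> 0 < g x) -> (forall x, `|x - t| < d -> N x) ->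
  0 < \int[phi]_x (g x * \1_N x).
Proof.
move=> It d0 mg gM mN gN tN; apply: (@supp_Rintegral_gt0 _ phi supp _ t d M) => //.
- by apply: measurable_funM => //; exact: measurable_indic.
- move=> x; rewrite indicE; case: (boolP (x \in N)) => /= [/set_mem Nx|_].
    have gx := gN x Nx.
    by rewrite mulr1 ltW//=; apply: le_trans (gM x); exact: ler_norm.
  by rewrite mulr0 lexx /=; apply: le_trans (gM x).
- by move=> x /tN Nx; rewrite indicE mem_set// mulr1; exact: gN.
Qed.

Lemma optimal_pairwise_disclosure (pifd : probability (R * R)%type R) :
  full_disclosure phi u pifd -> optimal phi V u pifd -> pairwise_disclosure.
Proof.
move=> fd opt a t1 t2 Ia I1 I2 n1 p2; rewrite leNgt; apply/negP => gain.
pose D t := V a (clamp01 t) - fd_price V u (clamp01 t).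
pose g t := u a (clamp01 t).
have [n1' p2'] : g t1 < 0 /\ 0 < g t2 by rewrite /g !clamp01_id.
have gain' : 0 < D t1 * g t2 - D t2 * g t1 by rewrite /D /g !clamp01_id.
(* k is strictly between the two slopes, so w is positive near t1 and t2, while
   the k-terms cancel by obedience. *)
pose k := (D t1 / - g t1 - D t2 / g t2) / 2.
pose w t := D t + k * g t.
have w1 : 0 < w t1.
  have -> : w t1 = (D t1 * g t2 - D t2 * g t1) / (2 * g t2).
    by rewrite /w /k; field; apply/andP; split; apply/eqP; lra.
  by rewrite divr_gt0// mulr_gt0.
have w2 : 0 < w t2.
  have -> : w t2 = (D t1 * g t2 - D t2 * g t1) / (2 * - g t1).
    by rewrite /w /k; field; apply/andP; split; apply/eqP; lra.
  by rewrite divr_gt0// mulr_gt0// oppr_gt0.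
have cg : continuous g := cont2_on01_r u a cu Ia.
have cD : continuous D.
  by move=> t; apply: cvgB; [exact: (cont2_on01_r V a cV Ia t)|exact: fd_price_continuous].
have cw : continuous w.
  by move=> t; apply: cvgD; [exact: cD|apply: cvgM; [exact: cvg_cst|exact: cg]].
have mg := continuous_measurable_fun cg.
have mD := continuous_measurable_fun cD.
have mw := continuous_measurable_fun cw.
have [Mg gM] := clamp01_bounded (u a) cg.
have [MD DM] : exists M, forall t, `|D t| <= M.
  have [MV VM] := clamp01_bounded (V a) (cont2_on01_r V a cV Ia).
  have [Mp pM] := clamp01_bounded _ fd_price_continuous.
  exists (MV + Mp) => t; apply: le_trans (ler_normB _ _) _.
  by apply: lerD; [exact: VM|exact: pM].
have wM t : `|w t| <= MD + `|k| * Mg.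
  apply: le_trans (ler_normD _ _) _; rewrite normrM.
  by apply: lerD; [exact: DM|apply: ler_wpM2l => //; exact: gM].
have IDg (N : set R) : measurable N ->
    \int[phi]_t (D t * \1_N t) =
    \int[phi]_t (w t * \1_N t) - k * \int[phi]_t (g t * \1_N t).
  move=> mN; have mI : measurable_fun setT (\1_N : R -> R) by exact: measurable_indic.
  have Ig : phi.-integrable setT (EFin \o (fun t => g t * \1_N t)).
    apply: (@probability_integrable _ _ _ _ _ Mg); first exact: measurable_funM.
    by move=> x; apply: indic_mul_bounded; exact: gM.
  rewrite -RintegralZl// -RintegralB//.
  - by apply: eq_Rintegral => x _; rewrite /w; ring.
  - apply: (@probability_integrable _ _ _ _ _ (MD + `|k| * Mg)); first exact: measurable_funM.
    by move=> x; apply: indic_mul_bounded; exact: wM.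
  - apply: (@probability_integrable _ _ _ _ _ (`|k| * Mg)).
      by apply: measurable_funM => //; exact: measurable_funM.
    by move=> x; rewrite normrM; apply: ler_wpM2l => //; apply: indic_mul_bounded; exact: gM.
(* The pooled sets are not small neighbourhoods but all states with [w > 0] on each side of the zero
   of [g]. They contain neighbourhoods of [t1] and [t2], so full support makes the integrals below
   strictly signed. *)
pose N1 := (w @^-1` `]0, +oo[) `&` (g @^-1` `]-oo, 0[).
pose N2 := (w @^-1` `]0, +oo[) `&` (g @^-1` `]0, +oo[).
have mpre (f : R -> R) (i : interval R) : measurable_fun setT f ->
    measurable (f @^-1` [set` i]).
  by move=> mf; rewrite -[X in measurable X]setTI; apply: mf.
have mN1 : measurable N1 by apply: measurableI; apply: mpre.
have mN2 : measurable N2 by apply: measurableI; apply: mpre.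
have N1P t : N1 t -> 0 < w t /\ g t < 0 by rewrite /N1 /= !in_itv /= andbT; case.
have N2P t : N2 t -> 0 < w t /\ 0 < g t by rewrite /N2 /= !in_itv /= !andbT; case.
have near (f : R -> R) t : continuous f -> 0 < f t ->
    exists2 d : R, 0 < d & forall y, `|y - t| < d -> 0 < f y.
  move=> cf ft; have [d d0 H] := continuous_eps f cf t _ ft.
  by exists d => // y /H /ltr_normlP[]; lra.
have cNg : continuous (fun t => - g t) by move=> t; apply: cvgN; exact: cg.
have [d1 d10 B1] : exists2 d : R, 0 < d & forall y, `|y - t1| < d -> N1 y.
  have [d d0 H] := near w t1 cw w1.
  have [d' d0' H'] := near (fun t => - g t) t1 cNg ltac:(by rewrite oppr_gt0).
  exists (Order.min d d'); first by rewrite lt_min d0.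
  move=> y; rewrite lt_min => /andP[/H ? /H' ?].
  by rewrite /N1 /= !in_itv /= andbT; split => //; lra.
have [d2 d20 B2] : exists2 d : R, 0 < d & forall y, `|y - t2| < d -> N2 y.
  have [d d0 H] := near w t2 cw w2.
  have [d' d0' H'] := near g t2 cg p2'.
  exists (Order.min d d'); first by rewrite lt_min d0.
  move=> y; rewrite lt_min => /andP[/H ? /H' ?].
  by rewrite /N2 /= !in_itv /= !andbT.
have W1 : 0 < \int[phi]_t (w t * \1_N1 t).
  by apply: (Rintegral_restrict_gt0 w N1 t1 d1 _ I1 d10 mw wM mN1) => // x /N1P[].
have W2 : 0 < \int[phi]_t (w t * \1_N2 t).
  by apply: (Rintegral_restrict_gt0 w N2 t2 d2 _ I2 d20 mw wM mN2) => // x /N2P[].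
have J2 : 0 < \int[phi]_t (g t * \1_N2 t).
  by apply: (Rintegral_restrict_gt0 g N2 t2 d2 _ I2 d20 mg gM mN2) => // x /N2P[].
have J1 : \int[phi]_t (g t * \1_N1 t) < 0.
  have : 0 < \int[phi]_t (- g t * \1_N1 t).
    apply: (Rintegral_restrict_gt0 _ N1 t1 d1 Mg I1 d10 _ _ mN1) => //.
    - exact: continuous_measurable_fun.
    - by move=> x; rewrite normrN; exact: gM.
    - by move=> x /N1P[_]; rewrite oppr_gt0.
  under eq_Rintegral do rewrite mulNr -mulN1r.
  rewrite RintegralZl//; first by rewrite mulN1r oppr_gt0.
  apply: (@probability_integrable _ _ _ _ _ Mg).
    by apply: measurable_funM => //; exact: measurable_indic.
  by move=> x; apply: indic_mul_bounded; exact: gM.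
have ID1 := IDg _ mN1; have ID2 := IDg _ mN2.
move: J1 J2 W1 W2 ID1 ID2.
set j1 := \int[phi]_t (g t * \1_N1 t); set j2 := \int[phi]_t (g t * \1_N2 t).
set i1 := \int[phi]_t (w t * \1_N1 t); set i2 := \int[phi]_t (w t * \1_N2 t).
move=> J1 J2 W1 W2 ID1 ID2.
(* The solution of [c * j1 + (1 - c) * j2 = 0]; since [j1 < 0 < j2] both weights are positive, and
   the gain [c * i1 + (1 - c) * i2] is strict. *)
pose c := j2 / (j2 - j1).
have j0 : 0 < j2 - j1 by lra.
have c0 : 0 < c by rewrite divr_gt0.
have c1E : 1 - c = - j1 / (j2 - j1) by rewrite /c; field; apply/eqP; lra.
have c1 : 0 < 1 - c by rewrite c1E divr_gt0// oppr_gt0.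
have bal : c * j1 + (1 - c) * j2 = 0.
  by rewrite c1E /c; field; apply/eqP; lra.
have c01 : 0 <= c <= 1 by apply/andP; split; lra.
have [pi ipi vpi] := pool_implementable a N1 N2 c Ia mN1 mN2 c01 bal.
have := opt.2 pi ipi.
rewrite vpi (sender_valueE pifd opt.1.1) (full_disclosure_value pifd fd) lee_fin.
rewrite -[leRHS]addr0 lerD2l leNgt => /negP; apply.
rewrite -!/(D _) ID1 ID2.
rewrite (_ : _ + _ = c * i1 + (1 - c) * i2 - k * (c * j1 + (1 - c) * j2)); last by ring.
by rewrite bal mulr0 subr0 addr_gt0// mulr_gt0.
Qed.

(** * Dual feasibility of the disclosure price and the resulting contact set *)

Hypothesis PW : pairwise_disclosure.

(** For an interior action the states 0 and 1 lie strictly on opposite sides of the zero of [u a]: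
    state 0 makes the set of lower slopes nonempty, state 1 bounds it above, and its supremum
    separates. *)
Lemma fd_multiplier_interior a : 0 < a < 1 -> exists r, forall t, I01 t ->
  V a t + r * u a t <= fd_price V u t.
Proof.
move=> a01; have Ia : I01 a by case/andP: a01 => ? ?; apply/andP; split; lra.
case/andP: a01 => a0 a1.
have u0 : u a 0 < 0.
  rewrite u_lt0//; last exact: I01_0.
  by rewrite (astar_pt_uniq 0 0)//; [exact: I01_0..|exact: u00].
have u1 : 0 < u a 1.
  rewrite u_gt0//; last exact: I01_1.
  by rewrite (astar_pt_uniq 1 1)//; [exact: I01_1..|exact: u11].
pose D t := V a t - fd_price V u t.
pose S := [set D t / (- u a t) | t in [set t | I01 t /\ u a t < 0]].
have cmp t1 t2 : I01 t1 -> I01 t2 -> u a t1 < 0 -> 0 < u a t2 ->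
    D t1 / (- u a t1) <= - D t2 / u a t2.
  move=> I1 I2 n1 p2; rewrite ler_pdivrMr ?oppr_gt0// mulrAC ler_pdivlMr//.
  by have := PW a t1 t2 Ia I1 I2 n1 p2; rewrite -!/(D _); lra.
have S0 : S !=set0 by exists (D 0 / (- u a 0)), 0 => //; split => //; exact: I01_0.
have ubS t2 : I01 t2 -> 0 < u a t2 -> ubound S (- D t2 / u a t2).
  by move=> I2 p2 _ [t1 [I1 n1] <-]; exact: cmp.
exists (sup S) => t It.
suff : D t + sup S * u a t <= 0 by rewrite /D; lra.
have [n|p|z] := ltgtP (u a t) 0.
- have : D t / (- u a t) <= sup S.
    apply: sup_upper_bound; last by exists t.
    by split => //; exists (- D 1 / u a 1); apply: ubS => //; exact: I01_1.
  by rewrite ler_pdivrMr ?oppr_gt0//; lra.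
- have : sup S <= - D t / u a t by apply: sup_le_ub => //; exact: ubS.
  by rewrite ler_pdivlMr//; lra.
- rewrite z mulr0 addr0 /D /fd_price.
  by rewrite (astar_pt_uniq a)// subrr.
Qed.

(** The separating multiplier of an interior action must be [fd_mult], by the first-order condition.
    Continuity in the action then gives the inequality at 0 and 1. *)
Lemma fd_mult_feasible a t : I01 a -> I01 t ->
  V a t + fd_mult v u ua a * u a t <= fd_price V u t.
Proof.
move=> Ia It; move: a Ia.
apply: (@continuous_le_I01 _ (fun a => V a t + fd_mult v u ua a * u a t)).
  move=> a; apply: cvgD; first exact: (cont2_on01_l V t cV It a).
  by apply: cvgM; [exact: fd_mult_continuous|exact: (cont2_on01_l u t cu It a)].
move=> a a01; have [r H] := fd_multiplier_interior a a01.
by have <- := multiplier_first_order a r a01 H; exact: H.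
Qed.

Lemma fd_dual_feasible : dual_feasible V u (fd_price V u) (fd_mult v u ua).
Proof.
split; first exact/within_I01_continuousP/fd_price_continuous.
split.
  apply: (eq_measurable_fun (fd_mult v u ua \o clamp01)).
    by move=> a; rewrite inE => Ia; rewrite /= clamp01_id.
  by apply: measurable_funTS; exact: continuous_measurable_fun fd_mult_continuous.
split.
  have [M H] := clamp01_bounded _ fd_mult_continuous.
  by exists M => a Ia; have := H a; rewrite clamp01_id.
by move=> a t Ia It; have := fd_mult_feasible a t Ia It; lra.
Qed.
Variable p : R -> R.
Hypothesis dualp : dual_solution phi V u p.

(** The dual constraint at the action [astar_pt u t] loses its multiplier term and gives
    [fd_price <= p]. Feasibility of [fd_price] gives the reverse inequality between integrals, and a
    continuous gap with nonpositive integral vanishes under full support. *)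
Lemma dual_solution_price t : I01 t -> p t = fd_price V u t.
Proof.
have [[q [cp [_ [_ feas]]]] pmin] := dualp.
have le_p x : I01 x -> fd_price V u x <= p x.
  move=> Ix; have [Ia ua0] := astar_ptP x Ix.
  by have := feas _ x Ia Ix; rewrite ua0 mulr0 subr0.
move/within_I01_continuousP : cp => cp.
have := pmin _ _ (fd_dual_feasible).
pose g x := p (clamp01 x) - fd_price V u (clamp01 x).
have cg : continuous g.
  by move=> x; apply: cvgB; [exact: cp|exact: fd_price_continuous].
have [Mp pM] := clamp01_bounded _ cp.
have [Ms sM] := clamp01_bounded _ fd_price_continuous.
have mp := continuous_measurable_fun cp.
have ms := continuous_measurable_fun fd_price_continuous.
have mI := @measurable_I01 R.
rewrite (@Rintegral_full _ _ _ _ _ p _ _ mI supp.1 mp pM); last first.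
  by move=> x Ix; rewrite /= clamp01_id.
rewrite (@Rintegral_full _ _ _ _ _ _ _ _ mI supp.1 ms sM); last first.
  by move=> x Ix; rewrite /= clamp01_id.
rewrite lee_fin -subr_le0 -RintegralB//; last 2 first.
- exact: probability_integrable pM.
- exact: probability_integrable sM.
move=> le0 It; apply/eqP; rewrite eq_le le_p// andbT leNgt; apply/negP => lt_p.
have gt : 0 < g t by rewrite /g !clamp01_id// subr_gt0.
have [d d0 H] := continuous_eps g cg t _ gt.
suff : 0 < \int[phi]_x g x by rewrite ltNge le0.
apply: (@supp_Rintegral_gt0 _ phi supp _ t d (Mp + Ms)) => //.
- exact: continuous_measurable_fun.
- move=> x; rewrite subr_ge0 le_p//=; last exact: clamp01_in.
  apply: le_trans (ler_norm _) _; apply: le_trans (ler_normB _ _) _.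
  by apply: lerD; [exact: pM|exact: sM].
- by move=> x /H /ltr_normlP[]; lra.
Qed.

(** The test in [qmult] succeeds at every action: [p] is the disclosure price, and the action
    disclosed at [thetastar u a] is [a]. *)
Lemma qmultE a : I01 a -> qmult V v u ua p a = fd_mult v u ua a.
Proof.
move=> Ia; have [It ut] := thetastarP a Ia.
rewrite /qmult; case: asboolP => // -[]; split => //.
by rewrite dual_solution_price// /fd_price astar_ptK.
Qed.

Definition slack a t : R :=
  fd_price V u t - V a t - fd_mult v u ua a * u a t.

Lemma slack_ge0 a t : I01 a -> I01 t -> 0 <= slack a t.
Proof. by move=> Ia It; rewrite /slack; have := fd_mult_feasible a t Ia It; lra. Qed.

Lemma Gamma_secP a t : I01 a -> I01 t ->
  Gamma_sec V v u ua p a t <-> slack a t = 0.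
Proof.
move=> Ia It; rewrite /Gamma_sec /Gamma /= qmultE// dual_solution_price// /slack.
by split=> [[_ [_ ->]]|H]; [ring|do 2?split => //; lra].
Qed.

(** The section would contain [t1 < thetastar u a < t2]. Then [thetastar u a] is neither its infimum
    nor its supremum, so the starred section is the full one and has three distinct points. *)
Lemma contact_one_sided a t1 t2 : I01 a -> I01 t1 -> I01 t2 ->
  at_most_two (Gammastar_sec V v u ua p a) ->
  slack a t1 = 0 -> slack a t2 = 0 -> u a t1 < 0 -> 0 < u a t2 -> False.
Proof.
move=> Ia I1 I2; have [Is us] := thetastarP a Ia.
move=> two /(Gamma_secP a t1 Ia I1) G1 /(Gamma_secP a t2 Ia I2) G2.
rewrite u_lt0_thetastar// u_gt0_thetastar// => lt1 lt2.
have Gs : Gamma_sec V v u ua p a (thetastar u a).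
  by apply/Gamma_secP => //; rewrite /slack us /fd_price astar_ptK//; ring.
have sub t : Gamma_sec V v u ua p a t -> 0 <= t <= 1 by case=> _ [].
move: two; rewrite /Gammastar_sec; case: asboolP => [[_ [sE|sE]] _|_ [x [y xy]]].
- have : inf (Gamma_sec V v u ua p a) <= t1.
    by apply: inf_lbound => //; exists 0 => t /sub /andP[].
  by rewrite -sE leNgt lt1.
- have : t2 <= sup (Gamma_sec V v u ua p a).
    by apply: sup_ubound => //; exists 1 => t /sub /andP[].
  by rewrite -sE leNgt lt2.
- by have := xy _ G1; have := xy _ G2; have := xy _ Gs;
    move=> /= [e1|e1] [e2|e2] [e3|e3]; lra.
Qed.

(** * Complementary slackness and uniqueness *)

Hypothesis two : forall a, I01 a -> at_most_two (Gammastar_sec V v u ua p a).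

Let uc (z : R * R) := clamp2 u z.
Let sc (z : R * R) := clamp2 slack z.

Let cuc : continuous uc. Proof. exact: cont2_on01_clamp. Qed.

Let csc : continuous sc.
Proof.
have cf : continuous (fst : R * R -> R) by move=> z; exact: cvg_fst.
have cs : continuous (snd : R * R -> R) by move=> z; exact: cvg_snd.
move=> z; rewrite /sc /clamp2 /slack; apply: cvgB; first apply: cvgB.
- exact: (@continuous_comp _ _ _ snd (fd_price V u \o clamp01) z (cs z) (fd_price_continuous _)).
- exact: (cont2_on01_clamp V cV).
- apply: cvgM; last exact: cuc.
  exact: (@continuous_comp _ _ _ fst (fd_mult v u ua \o clamp01) z (cf z) (fd_mult_continuous _)).
Qed.

(** At these actions one-sidedness gives [u <= 0] on the whole contact section; at all other actions
    of [0,1], [u >= 0] there by definition. One set thus separates the two signs. *)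
Definition low_actions : set R :=
  [set a | I01 a /\ exists t, [/\ I01 t, slack a t = 0 & u a t < 0]].

(** A projection of a Borel set need not be Borel. Replacing [u < 0] by [u <= -1/(n+1)] makes each
    piece a closed part of the square, hence compact, with compact projection. *)
Lemma measurable_low_actions : measurable low_actions.
Proof.
pose K (n : nat) : set (R * R) := (I01 `*` I01) `&`
  ((sc @^-1` [set 0]) `&` (uc @^-1` [set x | x <= - n.+1%:R^-1])).
have cK n : compact (K n).
  apply: (@subclosed_compact _ _ (I01 `*` I01)).
  - apply: closedI.
      by apply: compact_closed => //; apply: compact_setX; rewrite I01_itv; exact: segment_compact.
    have /continuous_closedP csc' := csc; have /continuous_closedP cuc' := cuc.
    by apply: closedI; [exact: csc'|apply: cuc'; exact: closed_le].
  - by apply: compact_setX; rewrite I01_itv; exact: segment_compact.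
  - by move=> z [].
rewrite (_ : low_actions = \bigcup_n (fst @` K n)).
  apply: bigcupT_measurable => n; apply: compact_measurable.
  apply: continuous_compact => //; apply: continuous_subspaceT => z; exact: cvg_fst.
apply/seteqP; split=> [a [Ia [t [It s0 ut]]]|a [n _ [[b t] [/= [Ib It] [s0 ut]] <-]]].
  have [n un] : exists n : nat, n.+1%:R^-1 <= - u a t.
    exists (Num.truncn (- u a t)^-1).
    rewrite -[leRHS]invrK lef_pV2 ?posrE ?invr_gt0 ?oppr_gt0//.
    exact/ltW/truncnS_gt.
  exists n => //; exists (a, t) => //; split => //; split.
    by rewrite /sc /= clamp2_id.
  by rewrite /uc /= clamp2_id// lerNr.
split => //; exists t; split => //.
  by move: s0; rewrite /sc clamp2_id.
move: ut; rewrite /uc clamp2_id// => /le_lt_trans; apply.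
by rewrite oppr_lt0 invr_gt0.
Qed.

(** The integral of the slack is the disclosure value minus the value of [pi] minus the integral of
    [fd_mult * u]. The first two agree by optimality of both outcomes, the last is zero by obedience
    extended to bounded multipliers, and the slack is nonnegative. *)
Lemma optimal_contact pifd (pi : probability (R * R)%type R) :
  full_disclosure phi u pifd -> optimal phi V u pifd -> optimal phi V u pi ->
  pi [set z | sc z != 0] = 0%E.
Proof.
move=> fd [ifd maxfd] [ipi maxpi]; have [opi [marg obed]] := ipi.
have [MV VM] := clamp2_bounded V cV.
have [Mu uM] := clamp2_bounded u cu.
have mV := clamp2_measurable V cV.
have mu := clamp2_measurable u cu.
have [Mp pM] := clamp01_bounded _ fd_price_continuous.
have mp := continuous_measurable_fun fd_price_continuous.
have [Mq qM] := clamp01_bounded _ fd_mult_continuous.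
have mq := continuous_measurable_fun fd_mult_continuous.
have valE : \int[pi]_z clamp2 V z = \int[phi]_t fd_price V u (clamp01 t).
  rewrite -(full_disclosure_value pifd fd).
  have := maxfd pi ipi; have := maxpi pifd ifd.
  rewrite (sender_valueE pi opi) (sender_valueE pifd ifd.1) !lee_fin => H1 H2.
  by apply/eqP; rewrite eq_le H1 H2.
have qu0 : \int[pi]_z (uc z * (fd_mult v u ua \o clamp01) z.1) = 0.
  apply: (@Rintegral_level_mult _ _ _ pi fst uc Mu _ _ _ _ _ Mq) => //.
  - by move=> B mB; have := obed B mB; rewrite obedience_integralE// => -[].
have msc : measurable_fun setT sc by exact: continuous_measurable_plane.
have scE z : sc z = (fd_price V u \o clamp01) z.2 - clamp2 V z -
   uc z * (fd_mult v u ua \o clamp01) z.1 by rewrite /sc /clamp2 /slack /= mulrC.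
have mp2 : measurable_fun setT (fun z : R * R => (fd_price V u \o clamp01) z.2).
  exact: (@measurableT_comp _ _ _ _ _ _ (fd_price V u \o clamp01) _ snd).
have Ip2 : pi.-integrable setT (EFin \o (fun z : R * R => (fd_price V u \o clamp01) z.2)).
  by apply: (@probability_integrable _ _ _ _ _ Mp) => // z; exact: pM.
have IV : pi.-integrable setT (EFin \o clamp2 V) by exact: probability_integrable VM.
have mqu : measurable_fun setT (fun z : R * R => uc z * (fd_mult v u ua \o clamp01) z.1).
  by apply: measurable_funM => //;
    exact: (@measurableT_comp _ _ _ _ _ _ (fd_mult v u ua \o clamp01) _ fst).
have quM (z : R * R) : `|uc z * (fd_mult v u ua \o clamp01) z.1| <= Mu * Mq.
  by rewrite normrM; apply: ler_pM => //; exact: qM.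
have scM z : `|sc z| <= Mp + MV + Mu * Mq.
  rewrite scE; apply: le_trans (ler_normB _ _) _; apply: lerD => //.
  by apply: le_trans (ler_normB _ _) _; apply: lerD; [exact: pM|exact: VM].
apply: (@Rintegral_eq0_null _ _ _ pi _ (Mp + MV + Mu * Mq)) => //.
  move=> z; rewrite slack_ge0; [|exact: clamp01_in..].
  by apply: le_trans (scM z); exact: ler_norm.
transitivity (\int[pi]_z ((fd_price V u \o clamp01) z.2 - clamp2 V z -
   uc z * (fd_mult v u ua \o clamp01) z.1)).
  by apply: eq_Rintegral => z _; exact: scE.
rewrite RintegralB//; last 2 first.
- apply: (@probability_integrable _ _ _ _ _ (Mp + MV)).
    exact: measurable_funB.
  by move=> z; apply: le_trans (ler_normB _ _) _; apply: lerD; [exact: pM|exact: VM].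
- exact: probability_integrable quM.
rewrite RintegralB// qu0 subr0 valE.
by rewrite (outcome_marginal _ _ opi marg _ _ mp pM) subrr.
Qed.

Lemma optimal_obedient_pointwise pifd (pi : probability (R * R)%type R) :
  full_disclosure phi u pifd -> optimal phi V u pifd -> optimal phi V u pi ->
  pi [set z | uc z != 0] = 0%E.
Proof.
move=> fd ofd oppi; have s0 := optimal_contact _ _ fd ofd oppi.
have [[opi [marg obed]] _] := oppi.
have [Mu uM] := clamp2_bounded u cu.
have muc := clamp2_measurable u cu.
have msc : measurable_fun setT sc by exact: continuous_measurable_plane.
pose N := [set z | sc z != 0] `|` ~` (I01 `*` I01).
have mS := @measurable_square R.
have mN : measurable N by apply: measurableU; [exact: measurable_neq0|exact: measurableC].
have pS0 : pi (~` (I01 `*` I01)) = 0%E by rewrite probability_setC// opi subee.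
have N0 : pi N = 0%E by apply: null_set_setU => //; [exact: measurable_neq0|exact: measurableC].
have NP z : ~ N z -> [/\ I01 z.1, I01 z.2 & slack z.1 z.2 = 0].
  move=> Nz; have [I1 I2] : (I01 `*` I01) z by apply: contrapT => ?; apply: Nz; right.
  split => //; have : sc z = 0.
    by apply/eqP/negPn/negP => ?; apply: Nz; left.
  by rewrite /sc /clamp2 !clamp01_id.
have mB := measurable_low_actions.
have mind (B : set R) : measurable B -> measurable_fun setT (fun z : R * R => uc z * \1_B z.1).
  move=> mB'; apply: measurable_funM => //.
  by apply: (@measurableT_comp _ _ _ _ _ _ (\1_B : R -> R)) => //; exact: measurable_indic.
have int0 (B : set R) : measurable B -> \int[pi]_z (uc z * \1_B z.1) = 0.
  by move=> mB'; have := obed B mB'; rewrite obedience_integralE// => -[].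
have ucE z : I01 z.1 -> I01 z.2 -> uc z = u z.1 z.2.
  by case: z => a t /= ? ?; rewrite /uc clamp2_id.
(* An action in [low_actions] has a contact state with [u < 0], so a contact pair there with [u > 0]
   is excluded by one-sidedness. *)
have lowB : pi [set z | uc z * \1_low_actions z.1 != 0] = 0%E.
  rewrite (_ : [set z | _] = [set z | - (uc z * \1_low_actions z.1) != 0]); last first.
    by apply/seteqP; split => z /=; rewrite oppr_eq0.
  apply: (@Rintegral_eq0_null_ae _ _ _ pi _ Mu N) => //.
  - by apply: measurableT_comp => //; exact: mind.
  - by move=> z; rewrite normrN; exact: indic_mul_bounded.
  - move=> z /NP[I1 I2 sz]; rewrite indicE; case: (boolP (z.1 \in low_actions)).
      rewrite inE => -[_ [t [It st ut]]]; rewrite mulr1 oppr_ge0 ucE// leNgt.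
      by apply/negP => uz; exact: (contact_one_sided _ t z.2 I1 It I2 (two _ I1)).
    by rewrite mulr0 oppr0.
  - under eq_Rintegral do rewrite -mulN1r.
    rewrite RintegralZl// ?int0// ?mulr0//.
    apply: (@probability_integrable _ _ _ _ _ Mu); first exact: mind.
    by move=> z; exact: indic_mul_bounded.
(* Conversely, a contact pair with [u < 0] would itself place its action in [low_actions]. *)
have highB : pi [set z | uc z * \1_(~` low_actions) z.1 != 0] = 0%E.
  apply: (@Rintegral_eq0_null_ae _ _ _ pi _ Mu N) => //.
  - by apply: mind; exact: measurableC.
  - by move=> z; exact: indic_mul_bounded.
  - move=> z /NP[I1 I2 sz]; rewrite indicE; case: (boolP (z.1 \in ~` low_actions)).
      rewrite inE => nlow; rewrite mulr1 ucE// leNgt; apply/negP => uz.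
      by apply: nlow; split => //; exists z.2.
    by rewrite mulr0.
  - by apply: int0; exact: measurableC.
apply: (@subset_measure0 _ _ _ pi _ ([set z | uc z * \1_low_actions z.1 != 0] `|`
   [set z | uc z * \1_(~` low_actions) z.1 != 0])).
- exact: measurable_neq0.
- by apply: measurableU; apply: measurable_neq0; apply: mind => //; exact: measurableC.
- move=> z /= uz; have [zl|zl] := pselect (low_actions z.1).
    by left; rewrite indicE mem_set// mulr1.
  by right; rewrite indicE mem_set// mulr1.
- by apply: null_set_setU => //; apply: measurable_neq0; apply: mind => //; exact: measurableC.
Qed.

(** Off a null set every pair has [u = 0], that is, it lies on the graph of [fd_map]. There
    membership in [E] depends on the state alone, and the marginal condition evaluates it under
    [phi]. *)
Lemma optimal_unique (pifd pi : probability (R * R)%type R) :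
  full_disclosure phi u pifd -> optimal phi V u pifd -> optimal phi V u pi ->
  forall E, measurable E -> pi E = pifd E.
Proof.
move=> fd ofd oppi E mE; have u0 := optimal_obedient_pointwise _ _ fd ofd oppi.
have [[opi [marg _]] _] := oppi.
rewrite (full_disclosureE pifd fd)//.
have mfE : measurable (fd_map @^-1` E).
  by rewrite -[X in measurable X]setTI; exact: fd_map_measurable.
rewrite -marg//.
have muc := clamp2_measurable u cu.
have mZ : measurable [set z | uc z != 0] by exact: measurable_neq0.
have mS := @measurable_square R.
have pS0 : pi (~` (I01 `*` I01)) = 0%E by rewrite probability_setC// opi subee.
apply: (@measure_eq_off_null _ _ _ pi _ _ ([set z | uc z != 0] `|` ~` (I01 `*` I01))) => //.
- by apply: measurableX => //; exact: measurable_I01.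
- by apply: measurableU => //; exact: measurableC.
- by apply: null_set_setU => //; exact: measurableC.
- have key a t : ~ ([set z | uc z != 0] `|` ~` (I01 `*` I01)) (a, t) ->
    [/\ I01 a, I01 t & fd_map t = (a, t)].
    move=> H; have [Ia It] : (I01 `*` I01) (a, t) by apply: contrapT => ?; apply: H; right.
    split => //; have : uc (a, t) = 0 by apply/eqP/negPn/negP => ?; apply: H; left.
    rewrite /uc clamp2_id// => ua0; rewrite /fd_map clamp01_id//.
    by rewrite (astar_pt_uniq a t).
  apply/seteqP; split => -[a t] [H Nz]; have [Ia It e] := key a t Nz; split => //.
    by split => //=; rewrite e.
  by case: H => _ /=; rewrite e.
Qed.

End Disclosure.

Theorem theorem6 (R : realType) (phi : probability R R)
  (V U v u ua : R -> R -> R) (p : R -> R) :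
  supp_is_01 phi ->
  cont2_on01 V -> cont2_on01 U ->
  assumption1 V U v u ua -> assumption2 u ua ->
  assumption3 u -> assumption4 u ->
  dual_solution phi V u p ->
  (forall a, I01 a -> at_most_two (Gammastar_sec V v u ua p a)) ->
  forall pifd : probability (R * R)%type R,
    full_disclosure phi u pifd -> optimal phi V u pifd ->
    forall pi : probability (R * R)%type R, optimal phi V u pi ->
      forall E : set (R * R), measurable E -> pi E = pifd E.
Proof.
move=> supp cV _ A1 A2 A3 A4 dualp two pifd fd ofd pi opi.
have PW : pairwise_disclosure V u.
  by apply: (optimal_pairwise_disclosure V U v u ua) fd ofd.
by apply: (optimal_unique V U v u ua cV A1 A2 A3 A4 phi supp PW p dualp two).
Qed.
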